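(* Let $\sigma>0$ and $\beta\ge0$, where $\beta>0$ refers to the discounted model and $\beta=0$ to the ergodic model. Set $\kappa_c:=2\beta\sigma^2+4\sigma^4$ and, for $\kappa>\kappa_c$, $$\bar q:=\frac{\bar a}{\bar a+2\sigma^2},\qquad \bar a:=-(\beta+3\sigma^2)+\sqrt{(\beta+3\sigma^2)^2+2(\kappa-\kappa_c)}>0 .$$ Both in the ergodic and discounted models, the uniform distribution $q=0$ is a stationary Nash equilibrium (SNE) for any $\kappa>0$. Moreover: (i) (Subcritical case) for $\kappa<\kappa_c$, the uniform distribution is the only SNE; (ii) (Supercritical case) for $\kappa>\kappa_c$, there are exactly three SNE, given by $q=-\bar q,\,0,\,\bar q$; (iii) (Full synchronization) as $\kappa\uparrow\infty$, $\bar q\uparrow1$.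
   Context: Let $\mathcal{X}=\{0,1\}$. The running cost is $\ell(0,p)=p$, $\ell(1,p)=1-p$ for $p\in[0,1]$. A probability measure on $\mathcal{X}$ is identified with the mass $p$ it gives to $1$, and we set $q=2p-1\in[-1,1]$; a flow $q(\cdot)$ is called a Nash equilibrium if the flow $p(\cdot)=(q(\cdot)+1)/2$ is one. $\mathcal{A}$ is the set of functions $\alpha:[0,\infty)\times\mathcal{X}\to[0,\infty)$ with $\alpha(\cdot,x)$ locally integrable. For $\alpha\in\mathcal{A}$, $X^{\alpha}$ is the continuous-time Markov chain on $\mathcal{X}$ with jump rate $\sigma^2+\alpha(t,0)$ from $0$ to $1$, jump rate $\sigma^2+\alpha(t,1)$ from $1$ to $0$, and $\mathbb{P}(X^{\alpha}_0=1)=p(0)$. Given a flow $p:[0,\infty)\to[0,1]$ and the interaction strength $\kappa>0$, define $$J_\beta(\alpha)=\mathbb{E}\int_0^\infty e^{-\beta t}\big(\tfrac12\alpha(t,X^{\alpha}_t)^2+\kappa\ell(X^{\alpha}_t,p(t))\big)dt\quad(\beta>0),$$ $$J_0(\alpha)=\limsup_{T\uparrow\infty}\frac1T\mathbb{E}\int_0^T\big(\tfrac12\alpha(t,X^{\alpha}_t)^2+\kappa\ell(X^{\alpha}_t,p(t))\big)dt .$$ For $\beta>0$, a flow $p$ is a discounted Nash equilibrium if there is $\alpha^*\in\mathcal{A}$ minimizing $J_\beta$ over $\mathcal{A}$ with $p(t)=\mathbb{P}(X^{\alpha^*}_t=1)$ for all $t\ge0$. A periodic or constant flow $p$ is an ergodic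 Nash equilibrium if the same holds with $J_0$ in place of $J_\beta$. A stationary Nash equilibrium (SNE) is a Nash equilibrium that is constant in time (its initial condition is part of the solution). *)

(* Defs.v *)
From HB Require Import structures.
From mathcomp Require Import all_boot all_order all_algebra.
From mathcomp Require Import all_classical all_reals all_analysis.

Set Implicit Arguments.
Unset Strict Implicit.
Unset Printing Implicit Defensive.

Import Order.TTheory GRing.Theory Num.Theory.
Import numFieldNormedType.Exports.

Local Open Scope classical_set_scope.
Local Open Scope ring_scope.

(* The state space {0,1} is bool, with 0 = false and 1 = true; in particular
   ~~ x is the state other than x. Time is a real number, and only the values
   at nonnegative times of flows, controls and processes are meaningful. *)

Definition control (R : realType) := R -> bool -> R.

Definition admissible (R : realType) (a : control R) : Prop :=
  (forall t x, 0 <= t -> 0 <= a t x) /\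
  (forall x T, 0 <= T ->
     (@lebesgue_measure R).-integrable `[0, T] (fun t => (a t x)%:E)).

(* The natural filtration of X at time s. *)
Definition past (R : realType) (Om : Type) (X : R -> Om -> bool) (s : R)
    : set (set Om) :=
  <<s [set A | exists u y, 0 <= u <= s /\ A = X u @^-1` [set y]] >>.

(* X is a continuous-time Markov chain on {0,1} that leaves the state x at
   time t with rate r t x, with P(X_0 = 1) = p0. The rates are only locally
   integrable in time, so they are prescribed through the integrated
   Kolmogorov forward equation of the transition probabilities
   P(X_t = ~~ x | X_s = x); it is multiplied by P(X_s = x), so that nothing has
   to be assumed about null events, and so is the Markov property. Since the
   state space is discrete, the cadlag property says that paths are locally
   constant on the right and on the left. *)
Definition markov_chain (R : realType) (d : measure_display)
    (Om : measurableType d) (P : probability Om R)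
    (r : R -> bool -> R) (p0 : R) (X : R -> Om -> bool) : Prop :=
  let ev s x := X s @^-1` [set x] in
  [/\ (forall t, 0 <= t -> measurable_fun setT (X t)),
      (forall w t, 0 <= t -> \forall u \near t^'+, X u w = X t w) /\
      (forall w t, 0 < t -> exists x, \forall u \near t^'-, X u w = x),
      P (ev 0 true) = p0%:E,
      (forall s t H x y, 0 <= s <= t -> past X s H ->
         (P (H `&` ev s x `&` ev t y) * P (ev s x) =
          P (H `&` ev s x) * P (ev s x `&` ev t y))%E) &
      (forall s t x, 0 <= s <= t ->
         fine (P (ev s x `&` ev t (~~ x))) =
         \int[lebesgue_measure]_(u in `[s, t])
           (fine (P (ev s x `&` ev u x)) * r u x
            - fine (P (ev s x `&` ev u (~~ x))) * r u (~~ x)))].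

(* X p0 a is a version of the controlled chain X^a started from the law giving
   mass p0 to 1; the costs below depend on X p0 a only through its law. *)
Definition controlled_chain (R : realType) (d : measure_display)
    (Om : measurableType d) (P : probability Om R) (sigma : R)
    (X : R -> control R -> R -> Om -> bool) : Prop :=
  forall p0 a, 0 <= p0 <= 1 -> admissible a ->
    markov_chain P (fun t x => sigma ^+ 2 + a t x) p0 (X p0 a).

Definition ell (R : realType) (x : bool) (p : R) : R :=
  if x then 1 - p else p.

Definition running_cost (R : realType) (kappa : R) (p : R -> R)
    (a : control R) (t : R) (x : bool) : R :=
  2^-1 * a t x ^+ 2 + kappa * ell x (p t).

Definition discounted_cost (R : realType) (d : measure_display)
    (Om : measurableType d) (P : probability Om R)
    (X : R -> control R -> R -> Om -> bool) (kappa beta : R) (p : R -> R)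
    (a : control R) : \bar R :=
  (\int[P]_w \int[lebesgue_measure]_(t in `[0%R, +oo[)
     (expR (- (beta * t)) * running_cost kappa p a t (X (p 0) a t w))%:E)%E.

Definition ergodic_cost (R : realType) (d : measure_display)
    (Om : measurableType d) (P : probability Om R)
    (X : R -> control R -> R -> Om -> bool) (kappa : R) (p : R -> R)
    (a : control R) : \bar R :=
  limf_esup (fun T : R => (T^-1)%:E *
    \int[P]_w \int[lebesgue_measure]_(t in `[0%R, T])
      (running_cost kappa p a t (X (p 0%R) a t w))%:E)%E +oo%R.

(* p is the flow of laws of a chain X^a whose control a minimizes the cost J
   over all admissible controls. *)
Definition equilibrium (R : realType) (d : measure_display)
    (Om : measurableType d) (P : probability Om R)
    (X : R -> control R -> R -> Om -> bool) (J : control R -> \bar R)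
    (p : R -> R) : Prop :=
  (forall t, 0 <= t -> 0 <= p t <= 1) /\
  exists a, [/\ admissible a,
    (forall b, admissible b -> (J a <= J b)%E) &
    (forall t, 0 <= t -> P (X (p 0) a t @^-1` [set true]) = (p t)%:E)].

Definition constant_flow (R : realType) (p : R -> R) : Prop :=
  forall t, 0 <= t -> p t = p 0.

Definition periodic_flow (R : realType) (p : R -> R) : Prop :=
  exists2 tau, 0 < tau & forall t, 0 <= t -> p (t + tau) = p t.

Definition discounted_nash (R : realType) (d : measure_display)
    (Om : measurableType d) (P : probability Om R)
    (X : R -> control R -> R -> Om -> bool) (kappa beta : R) (p : R -> R)
    : Prop :=
  equilibrium P X (discounted_cost P X kappa beta p) p.

Definition ergodic_nash (R : realType) (d : measure_display)
    (Om : measurableType d) (P : probability Om R)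
    (X : R -> control R -> R -> Om -> bool) (kappa : R) (p : R -> R) : Prop :=
  (periodic_flow p \/ constant_flow p) /\
  equilibrium P X (ergodic_cost P X kappa p) p.

(* beta = 0 stands for the ergodic model. *)
Definition nash (R : realType) (d : measure_display)
    (Om : measurableType d) (P : probability Om R)
    (X : R -> control R -> R -> Om -> bool) (kappa beta : R) (p : R -> R)
    : Prop :=
  if beta == 0 then ergodic_nash P X kappa p
  else discounted_nash P X kappa beta p.

(* The constant flow q, in the variable q = 2 p - 1, is a Nash equilibrium. *)
Definition stationary_nash (R : realType) (d : measure_display)
    (Om : measurableType d) (P : probability Om R)
    (X : R -> control R -> R -> Om -> bool) (kappa beta q : R) : Prop :=
  nash P X kappa beta (fun=> (q + 1) / 2).

Definition kappa_c (R : realType) (sigma beta : R) : R :=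
  2 * beta * sigma ^+ 2 + 4 * sigma ^+ 4.

Definition abar (R : realType) (sigma beta kappa : R) : R :=
  - (beta + 3 * sigma ^+ 2)
  + Num.sqrt ((beta + 3 * sigma ^+ 2) ^+ 2
              + 2 * (kappa - kappa_c sigma beta)).

Definition qbar (R : realType) (sigma beta kappa : R) : R :=
  abar sigma beta kappa / (abar sigma beta kappa + 2 * sigma ^+ 2).

(* Main.v *)
Require Import Defs.
From HB Require Import structures.
From mathcomp Require Import all_boot all_order all_algebra.
From mathcomp Require Import all_classical all_reals all_analysis.
From mathcomp Require Import measurable_realfun ring lra.
Import Order.TTheory GRing.Theory Num.Theory.
Import numFieldNormedType.Exports.
Local Open Scope classical_set_scope.
Local Open Scope ring_scope.

(** Fix a constant flow [p]. A verification argument shows that a single constant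
    feedback control is optimal, so that [p] is an equilibrium exactly when it is
    invariant for the chain driven by this feedback; what remains is algebra.

    The running cost depends on the path only through the current state, and
    right-continuous paths are jointly measurable; by Tonelli's theorem the cost
    is therefore an integral against the law [m t] of the chain
    ([integral_along_paths]), and [m] solves the integrated forward equation
    ([forward_equation]). The problem has become deterministic.

    Let [D] be the difference of the values of the states 1 and 0. It solves the
    equation [hjb], and the optimal rates are the negative part of [D] in the
    state 0 and its positive part in the state 1. Along an arbitrary admissible
    control the running cost equals [beta] times the value (the optimal average
    cost if [beta = 0]), plus a nonnegative gap, minus the drift of the value
    function ([mean_cost_decomposition]). Integrating, the discounted cost is the
    value at the initial law plus the discounted gap
    ([discounted_mean_cost]); in the ergodic problem the long time average is a
    constant plus the average gap ([undiscounted_mean_cost]). Hence the feedback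
    is optimal, and the gap of any other optimal control is small on some
    horizon. Since the gap is strongly convex in the rate, such a control has
    almost the same mean drift as the feedback; along a constant flow the
    integrated drift is zero, so the feedback leaves [p] invariant
    ([balanced_of_small_gap]). Conversely, if the feedback leaves [p] invariant,
    the forward equation has no other solution than the constant one
    ([balanced_flow_constant]). Together, this characterises the stationary
    equilibria of both models ([nash_iff_balanced]).

    In the variable [q = 2 p - 1], invariance says
    [q = - D / (2 sigma ^+ 2 + `|D|)]. Inserting this into [hjb], either [D = 0]
    and [q = 0], or
    [`|D| ^+ 2 / 2 + (beta + 3 sigma ^+ 2) `|D| = kappa - kappa_c]. The left-hand
    side vanishes at 0 and increases to infinity, so there is a positive solution
    exactly when [kappa > kappa_c]; it is [abar], it grows with [kappa] without
    bound, and the two signs of [D] give [qbar] and [- qbar]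
    ([hjb_balanced_iff]). *)

Set Implicit Arguments.
Unset Strict Implicit.
Unset Printing Implicit Defensive.

(** * Joint measurability of right-continuous processes *)

(** By right continuity [Y t w] is the limit of [Y u w], where [u] is the first
    point of the grid of mesh [1 / n.+1] that lies strictly after [t]. For a
    given [n] the graph of this approximation is a countable union of
    rectangles, so that the graph of [Y] is a liminf of measurable sets. This
    joint measurability is what allows Tonelli's theorem on the costs. *)
Lemma measurable_graph_right_continuous (R : realType) (d : measure_display)
    (Om : measurableType d) (Y : R -> Om -> bool) (y : bool) :
  (forall t, 0 <= t -> measurable_fun setT (Y t)) ->
  (forall w t, 0 <= t -> \forall u \near t^'+, Y u w = Y t w) ->
  measurable [set z : measurableTypeR R * Om | 0 <= z.1 /\ Y z.1 z.2 = y].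
Proof.
move=> mY rcY.
have ninv (n : nat) : 0 < n.+1%:R^-1 :> R by rewrite invr_gt0 ltr0n.
have grid (w : Om) (t : R) : 0 <= t -> exists N, forall n k : nat, (N <= n)%N ->
    k%:R / n.+1%:R <= t < k.+1%:R / n.+1%:R -> Y (k.+1%:R / n.+1%:R) w = Y t w.
  move=> t0; have [e /= e0 He] := rcY w t t0.
  have [N _ HN] := near_infty_natSinv_lt (PosNum e0).
  exists N => n k Nn /andP[k1 k2]; apply: He => //=.
  rewrite ltr0_norm ?subr_lt0// opprB.
  rewrite (le_lt_trans _ (HN n Nn))//= lerBlDr.
  by rewrite -natr1 mulrDl mul1r addrC lerD2l.
pose B (n k : nat) : set (measurableTypeR R * Om) :=
  `[k%:R / n.+1%:R, k.+1%:R / n.+1%:R[%classic `*`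
    (Y (k.+1%:R / n.+1%:R) @^-1` [set y]).
suff -> : [set z : measurableTypeR R * Om | 0 <= z.1 /\ Y z.1 z.2 = y] =
    \bigcup_N \bigcap_(n in [set n | (N <= n)%N]) \bigcup_k B n k.
  apply: bigcup_measurable => N _; apply: bigcap_measurable => [|n _].
    by exists N => /=.
  apply: bigcup_measurable => k _; apply: measurableX => //.
  by rewrite -[X in measurable X]setTI; apply: mY.
apply/seteqP; split=> [[t w] /= [t0 Ytw]|[t w] /= [N _ HN]].
  have [N HN] := grid w t t0; exists N => // n /= Nn.
  have tn0 : 0 <= t * n.+1%:R by rewrite mulr_ge0.
  have kt : (Num.truncn (t * n.+1%:R))%:R / n.+1%:R <= t <
            (Num.truncn (t * n.+1%:R)).+1%:R / n.+1%:R.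
    by rewrite ler_pdivrMr// ltr_pdivlMr// truncn_itv.
  exists (Num.truncn (t * n.+1%:R)) => //; split => /=.
    by rewrite in_itv.
  by rewrite (HN n).
have t0 : 0 <= t.
  have [k _ [/=]] := HN N (leqnn N).
  rewrite in_itv /= => /andP[k1 _] _; apply: le_trans k1.
  by rewrite divr_ge0.
split => //; have [N' HN'] := grid w t t0.
have [k _ [/=]] := HN (maxn N N') (leq_maxl _ _).
by rewrite in_itv /= => kt <-; rewrite -(HN' (maxn N N') k)// leq_maxr.
Qed.

(** * Laws along the paths of a process *)

Definition prob1 (R : realType) (d : measure_display) (Om : measurableType d)
    (P : probability Om R) (Y : R -> Om -> bool) (t : R) : R :=
  fine (P (Y t @^-1` [set true])).

Section prob1.
Context (R : realType) (d : measure_display) (Om : measurableType d).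
Context (P : probability Om R) (Y : R -> Om -> bool).
Let mu := @lebesgue_measure R.
Hypothesis mY : forall t, 0 <= t -> measurable_fun setT (Y t).
Hypothesis rcY : forall w t, 0 <= t -> \forall u \near t^'+, Y u w = Y t w.

Lemma measurable_state (t : R) (y : bool) : 0 <= t ->
  measurable (Y t @^-1` [set y]).
Proof. by move=> t0; rewrite -[X in measurable X]setTI; apply: mY. Qed.

Lemma prob1E (t : R) : 0 <= t ->
  P (Y t @^-1` [set true]) = (prob1 P Y t)%:E.
Proof.
by move=> t0; rewrite /prob1 fineK//; apply/fin_num_measure/measurable_state.
Qed.

Lemma prob1CE (t : R) : 0 <= t ->
  P (Y t @^-1` [set false]) = (1 - prob1 P Y t)%:E.
Proof.
move=> t0; have -> : Y t @^-1` [set false] = ~` (Y t @^-1` [set true]).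
  by apply/seteqP; split=> w /=; case: (Y t w).
by rewrite probability_setC ?prob1E//; exact: measurable_state.
Qed.

Lemma prob1_ge0 (t : R) : 0 <= prob1 P Y t.
Proof. by rewrite /prob1 fine_ge0. Qed.

Lemma prob1_le1 (t : R) : 0 <= t -> prob1 P Y t <= 1.
Proof.
by move=> t0; rewrite -lee_fin -prob1E// probability_le1//; exact: measurable_state.
Qed.

(** The map in question is the measure of the sections of the jointly measurable
    graph, cut by [B]. *)
Lemma measurable_prob_state (B : set Om) (y : bool) (D : set (measurableTypeR R)) :
  measurable B -> measurable D -> D `<=` [set t | 0 <= t] ->
  measurable_fun D (fun t => fine (P (B `&` Y t @^-1` [set y]))).
Proof.
move=> mB mD D0; apply: (measurableT_comp (fine_measurable measurableT)).
have mS := measurable_graph_right_continuous y mY rcY.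
have mSB : measurable ([set z : measurableTypeR R * Om | 0 <= z.1 /\ Y z.1 z.2 = y]
    `&` (setT `*` B)) by apply: measurableI => //; exact: measurableX.
have := measurable_fun_xsection P mSB; move/(measurable_funS measurableT (subsetT D)).
apply: eq_measurable_fun => t; rewrite inE => /D0 /= t0.
congr (P _); apply/seteqP; split => w; rewrite /xsection /= inE /=.
  by move=> [[_ ?] [_ ?]]; split.
by move=> [? ?]; split.
Qed.

Lemma measurable_prob1 (D : set (measurableTypeR R)) :
  measurable D -> D `<=` [set t | 0 <= t] -> measurable_fun D (prob1 P Y).
Proof.
move=> mD D0; have := @measurable_prob_state setT true D measurableT mD D0.
by apply: eq_measurable_fun => t _; rewrite setTI.
Qed.

(** Tonelli's theorem: a running cost depends on the path only through the
    current state, so its expectation depends on the chain only through its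
    one-dimensional laws. It turns the stochastic control problem into a
    deterministic one. *)
Lemma integral_along_paths (D : set (measurableTypeR R)) (f : R -> bool -> R) :
  measurable D -> D `<=` [set t | 0 <= t] ->
  (forall y, measurable_fun D (f ^~ y)) ->
  (forall t y, D t -> 0 <= f t y) ->
  (\int[P]_w \int[mu]_(t in D) (f t (Y t w))%:E =
   \int[mu]_(t in D) ((1 - prob1 P Y t) * f t false + prob1 P Y t * f t true)%:E)%E.
Proof.
move=> mD D0 mf f0.
pose S y := [set z : measurableTypeR R * Om | 0 <= z.1 /\ Y z.1 z.2 = y].
have mS y : measurable (S y) by exact: measurable_graph_right_continuous.
pose g y := f ^~ y \_ D.
have mg y : measurable_fun setT (g y) by apply/(measurable_restrictT _ mD).
have g0 y t : 0 <= g y t by rewrite /g patchE; case: ifPn => // /set_mem; exact: f0.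
pose F (z : measurableTypeR R * Om) : \bar R :=
  ((g false z.1 * \1_(S false) z)%:E + (g true z.1 * \1_(S true) z)%:E)%E.
have mgS y : measurable_fun setT
    (fun z : measurableTypeR R * Om => g y z.1 * \1_(S y) z).
  apply: measurable_funM; last exact: measurable_indic.
  by apply: measurableT_comp (mg y) _; exact: measurable_fst.
have mF : measurable_fun setT F.
  by apply: emeasurable_funD; apply/measurable_EFinP; exact: mgS.
have F0 z : (0 <= F z)%E.
  by rewrite adde_ge0// lee_fin mulr_ge0.
transitivity (\int[P]_w \int[mu]_t F (t, w))%E.
  apply: eq_integral => w _; rewrite integral_mkcond; apply: eq_integral => t _.
  rewrite patchE /F /= /g !patchE; case: ifPn => [/set_mem Dt|_]; last first.
    by rewrite !mul0r adde0.
  have t0 : 0 <= t := D0 _ Dt.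
  rewrite !indicE; case E : (Y t w).
    by rewrite memNset ?mem_set ?mulr0 ?mulr1 ?add0e// => -[_] /=; rewrite E.
  rewrite mem_set// memNset ?mulr0 ?mulr1 ?adde0// => -[_] /=; rewrite E//.
rewrite -(@fubini_tonelli _ _ _ _ _ mu P)//.
rewrite [RHS]integral_mkcond; apply: eq_integral => t _.
have St y w : 0 <= t -> \1_(S y) (t, w) = \1_(Y t @^-1` [set y]) w :> R.
  move=> t0; rewrite !indicE; congr (_%:R); congr (nat_of_bool _).
  by apply/idP/idP => /set_mem H; apply/mem_set; [case: H|split].
rewrite patchE; case: ifPn => [/set_mem Dt|nDt]; last first.
  by apply: integral0_eq => w _; rewrite /F /= /g !patchE (negbTE nDt) !mul0r adde0.
have t0 : 0 <= t := D0 _ Dt.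
have gt y : g y t = f t y by rewrite /g patchE mem_set.
transitivity (\int[P]_w ((f t false)%:E * (\1_(Y t @^-1` [set false]) w)%:E +
    (f t true)%:E * (\1_(Y t @^-1` [set true]) w)%:E))%E.
  by apply: eq_integral => w _; rewrite /F /= !gt !St.
have mI y : measurable_fun setT (fun w => (\1_(Y t @^-1` [set y]) w : R)%:E).
  by apply/measurable_EFinP/measurable_indic/measurable_state.
rewrite ge0_integralD//; last 4 first.
- by move=> w _; rewrite -EFinM lee_fin mulr_ge0// f0.
- exact: measurable_funeM.
- by move=> w _; rewrite -EFinM lee_fin mulr_ge0// f0.
- exact: measurable_funeM.
rewrite !ge0_integralZl ?lee_fin ?f0//; try by move=> w _; rewrite lee_fin.
rewrite !integral_indic ?setIT//; try exact: measurable_state.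
rewrite [X in (_ * X + _)%E](prob1CE t0) [X in (_ + _ * X)%E](prob1E t0).
by rewrite -!EFinM -EFinD ![f _ _ * _]mulrC.
Qed.
End prob1.

(** * The forward equation *)

(** The rates are only integrable, and they enter the forward equation multiplied
    by probabilities. *)
Lemma integrable_bounded_mul (R : realType) (D : set (measurableTypeR R))
    (M : R) (h g : R -> R) :
  measurable D -> measurable_fun D h -> (forall t, D t -> `|h t| <= M) ->
  (@lebesgue_measure R).-integrable D (EFin \o g) ->
  (@lebesgue_measure R).-integrable D (EFin \o (fun t => h t * g t)).
Proof.
move=> mD mh hM ig; have /measurable_EFinP mg := measurable_int _ ig.
apply: (le_integrable mD _ _ (integrableZl mD M ig)).
  by apply/measurable_EFinP; exact: measurable_funM.
move=> t Dt /=; rewrite lee_fin !normrM ler_wpM2r//.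
by rewrite (le_trans (hM _ Dt))// ler_norm.
Qed.

Section forward_equation.
Context (R : realType) (d : measure_display) (Om : measurableType d).
Context (P : probability Om R) (Y : R -> Om -> bool).
Context (r : R -> bool -> R) (p0 : R).
Let mu := @lebesgue_measure R.
Hypothesis chainY : markov_chain P r p0 Y.
Hypothesis ir : forall y T, 0 <= T -> mu.-integrable `[0, T] (EFin \o (r ^~ y)).

Let mY t : 0 <= t -> measurable_fun setT (Y t).
Proof. by case: chainY => + _ _ _ _; exact. Qed.

Let rcY w t : 0 <= t -> \forall u \near t^'+, Y u w = Y t w.
Proof. by case: chainY => _ [+ _] _ _ _; exact. Qed.

Let joint x u y := fine (P (Y 0 @^-1` [set x] `&` Y u @^-1` [set y])).

Let joint_sum_state x u : 0 <= u ->
  joint x u true + joint x u false = fine (P (Y 0 @^-1` [set x])).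
Proof.
move=> u0; have m0 y := measurable_state mY y (lexx 0).
have mu' y := measurable_state mY y u0.
rewrite /joint -fineD; try by apply: fin_num_measure; exact: measurableI.
rewrite -measureU; try by apply: measurableI.
  by rewrite -setIUr; congr (fine (P _)); apply/seteqP; split=> w /=;
    [case|move=> ->; split => //; case: (Y u w); [left|right]].
by apply/seteqP; split=> w //= [[_ ->] []].
Qed.

Let joint_sum_start u y : 0 <= u ->
  joint true u y + joint false u y = fine (P (Y u @^-1` [set y])).
Proof.
move=> u0; have m0 y' := measurable_state mY y' (lexx 0).
have mu' y' := measurable_state mY y' u0.
rewrite /joint -fineD; try by apply: fin_num_measure; exact: measurableI.
rewrite -measureU; try by apply: measurableI.
  by rewrite -setIUl; congr (fine (P _)); apply/seteqP; split=> w /=;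
    [case|move=> ->; split => //; case: (Y 0 w); [left|right]].
by apply/seteqP; split=> w //= [[-> _] []].
Qed.

Let joint_integrable x y z T : 0 <= T ->
  mu.-integrable `[0, T] (EFin \o (fun u => joint x u y * r u z)).
Proof.
move=> T0.
have sub : `[0, T] `<=` [set t | 0 <= t].
  by move=> t /=; rewrite in_itv => /andP[].
apply: (@integrable_bounded_mul _ _ 1) => //.
- by apply: measurable_prob_state => //; exact: measurable_state.
- move=> t /sub /= t0; rewrite ger0_norm ?fine_ge0//.
  rewrite -lee_fin fineK ?fin_num_measure ?probability_le1//;
    by apply: measurableI; exact: measurable_state.
- exact: ir.
Qed.

Lemma prob1_start : prob1 P Y 0 = p0.
Proof. by case: chainY => _ _ P0 _ _; rewrite /prob1 P0. Qed.

(** The equations for the transition probabilities out of the two possible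
    states at time 0, subtracted from each other. *)
Lemma forward_equation (T : R) : 0 <= T ->
  prob1 P Y T = p0 + \int[mu]_(t in `[0, T])
    ((1 - prob1 P Y t) * r t false - prob1 P Y t * r t true).
Proof.
move=> T0; case: chainY => _ _ _ _ fwd.
have /fwd/= e1 : 0 <= (0 : R) <= T by rewrite lexx.
have := e1 true; have := e1 false; rewrite /= -/(joint _ _ _) -/(joint _ _ _).
move=> {e1 fwd} ef et.
have -> : prob1 P Y T = p0 - joint true T false + joint false T true.
  rewrite -prob1_start {2}/prob1 -(joint_sum_state true T0) addrK.
  by rewrite (joint_sum_start true T0).
rewrite ef et -addrA; congr (_ + _); rewrite addrC -RintegralB//.
- apply: eq_Rintegral => t; rewrite inE /= in_itv /= => /andP[t0 _].
  have E1 : prob1 P Y t = joint true t true + joint false t true.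
    by rewrite (joint_sum_start true t0).
  have E0 : 1 - prob1 P Y t = joint true t false + joint false t false.
    by rewrite (joint_sum_start false t0) [P _](prob1CE P mY t0).
  rewrite E0 E1 -/(joint _ _ _) /joint; ring.
- exact: (integrableB _ (joint_integrable _ _ _ T0) (joint_integrable _ _ _ T0)).
- exact: (integrableB _ (joint_integrable _ _ _ T0) (joint_integrable _ _ _ T0)).
Qed.

End forward_equation.

(** * Discounted integrals *)

Section discounting.
Context (R : realType) (beta : R).
Hypothesis beta_gt0 : 0 < beta.
Let mu := @lebesgue_measure R.

Lemma integral_exp_tail (t : R) :
  (\int[mu]_(T in `[t, +oo[) (expR (- (beta * T)))%:E =
   (beta^-1 * expR (- (beta * t)))%:E)%E.
Proof.
pose F T := - (beta^-1 * expR (- (beta * T))).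
have dF (T : R) : is_derive T 1 F (expR (- (beta * T))).
  have := beta_gt0 => /lt0r_neq0 b0.
  rewrite /F; apply: is_derive_eq.
  rewrite /GRing.scale /= mulr1; field.
  exact: b0.
have cE : continuous (fun T => expR (- (beta * T))).
  move=> T; apply: continuous_comp; last exact: continuous_expR.
  by apply: continuousN; apply: mulrl_continuous.
rewrite (@ge0_continuous_FTC2y _ _ F t 0).
- by rewrite /F -EFinB sub0r opprK.
- by move=> T _; exact: expR_ge0.
- exact: continuous_subspaceT.
- rewrite -oppr0; apply: cvgN; rewrite -[X in _ --> X](mulr0 beta^-1).
  apply: cvgM; first exact: cvg_cst.
  have -> : (fun T => expR (- (beta * T))) = (fun T => expR (- T)) \o ( *%R beta) by [].
  by apply: (cvg_comp _ _ (gt0_cvgMry _ _)) => //; exact: cvgr_expR.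
- by move=> T _; case: (dF T).
- apply: cvg_at_right_filter.
  by apply: differentiable_continuous; apply/derivable1_diffP; case: (dF t).
- by move=> T _; rewrite derive1E; case: (dF T).
Qed.

Context (g : R -> R).
Hypothesis mg : measurable_fun (`[0, +oo[%classic : set (measurableTypeR R)) g.
Hypothesis g0 : forall t, 0 <= t -> 0 <= g t.

Let gD : R -> R := g \_ `[0, +oo[.
Let mgD : measurable_fun (setT : set (measurableTypeR R)) gD.
Proof. by apply/(measurable_restrictT _ (measurable_itv _)). Qed.

Let tri := [set z : measurableTypeR R * measurableTypeR R | 0 <= z.2 <= z.1].
Let mtri : measurable tri.
Proof.
have m1 : measurable_fun setT (fun z : measurableTypeR R * measurableTypeR R => 0 <= z.2).
  exact: measurable_fun_ler.
have m2 : measurable_fun setT (fun z : measurableTypeR R * measurableTypeR R => z.2 <= z.1).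
  exact: measurable_fun_ler.
have := measurableI _ _ (m1 measurableT [set true] I) (m2 measurableT [set true] I).
rewrite !setTI => H; rewrite /tri.
rewrite (_ : [set _ | _] = (fun z : R * R => 0 <= z.2) @^-1` [set true] `&`
  (fun z : R * R => z.2 <= z.1) @^-1` [set true])//.
by apply/seteqP; split=> z /=; [move/andP|move=> [-> ->]].
Qed.

Let k (z : measurableTypeR R * measurableTypeR R) : R := \1_tri z * gD z.2.

Let k0 z : 0 <= k z.
Proof.
rewrite /k indicE; case: (boolP (z \in tri)); rewrite ?mul0r// => /set_mem /andP[z2 _].
by rewrite mul1r /gD patchE mem_set ?g0//= in_itv/= z2.
Qed.

Let mk : measurable_fun setT k.
Proof.
apply: measurable_funM; first exact: measurable_indic.
by apply: measurableT_comp mgD _; exact: measurable_snd.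
Qed.

Let int_k T : (\int[mu]_(t in `[0%R, T]) (g t)%:E = \int[mu]_t (k (T, t))%:E)%E.
Proof.
rewrite [LHS]integral_mkcond; apply: eq_integral => t _.
rewrite patchE /k indicE /=; case: ifPn => [/set_mem /=|tT].
  rewrite in_itv /= => /andP[t0 tT]; rewrite mem_set /tri /= ?t0//.
  by rewrite mul1r /gD patchE mem_set//= in_itv /= t0.
by rewrite memNset ?mul0r// => /= H; move/negP: tT; apply; rewrite mem_set//= in_itv.
Qed.

Lemma measurable_running_integral (D : set (measurableTypeR R)) :
  measurable_fun D (fun T => \int[mu]_(t in `[0%R, T]) (g t)%:E)%E.
Proof.
apply: measurable_funTS; under eq_fun do rewrite int_k.
apply: (@measurable_fun_fubini_tonelli_F _ _ _ _ _ mu (fun z => (k z)%:E)).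
  exact/measurable_EFinP.
by move=> z; rewrite lee_fin k0.
Qed.

(** Tonelli's theorem, after writing the discount factor [exp (- beta t)] as the
    integral of [beta exp (- beta T)] over [T >= t]. It plays the role of an
    integration by parts against the running integral. *)
Lemma discounted_running_integral :
  (\int[mu]_(t in `[0%R, +oo[) (expR (- (beta * t)) * g t)%:E =
   beta%:E * \int[mu]_(T in `[0%R, +oo[) ((expR (- (beta * T)))%:E *
      \int[mu]_(t in `[0%R, T]) (g t)%:E))%E.
Proof.
have mexp (D : set (measurableTypeR R)) : measurable_fun D (fun T => expR (- (beta * T))).
  apply: measurable_funTS; apply: measurableT_comp; first exact: measurable_expR.
  by apply: measurable_funN; exact: mulrl_measurable.
pose K (z : measurableTypeR R * measurableTypeR R) := (expR (- (beta * z.1)) * k z)%:E.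
have mK : measurable_fun setT K.
  apply/measurable_EFinP; apply: measurable_funM => //.
  by apply: measurableT_comp (mexp setT) _; exact: measurable_fst.
have K0 z : (0 <= K z)%E by rewrite lee_fin mulr_ge0 ?expR_ge0.
have mkT T : measurable_fun setT (fun t => (k (T, t))%:E).
  apply/measurable_EFinP; exact: measurableT_comp mk (measurable_pair1 _).
have -> : (\int[mu]_(T in `[0%R, +oo[) ((expR (- (beta * T)))%:E *
      \int[mu]_(t in `[0%R, T]) (g t)%:E) = \int[mu]_T \int[mu]_t K (T, t))%E.
  rewrite integral_mkcond; apply: eq_integral => T _.
  rewrite patchE; case: ifPn => [_|].
    by rewrite int_k -ge0_integralZl// => t _; rewrite lee_fin.
  rewrite notin_setE /= in_itv /= andbT => /negP; rewrite -ltNge => T0.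
  apply/esym/integral0_eq => t _; rewrite /K /k indicE memNset ?mul0r ?mulr0//.
  by move=> /= /andP[t0 /(le_trans t0)]; rewrite leNgt T0.
rewrite (@fubini_tonelli _ _ _ _ _ mu mu)//.
rewrite -ge0_integralZl//; last 3 first.
- exact: measurable_fun_fubini_tonelli_G.
- by move=> t _; apply: integral_ge0 => T _; exact: K0.
- by rewrite lee_fin ltW.
rewrite [LHS]integral_mkcond; apply: eq_integral => t _.
rewrite patchE; case: ifPn => [|].
  rewrite inE /= in_itv /= andbT => t0.
  have -> : (\int[mu]_T K (T, t) =
      (g t)%:E * \int[mu]_(T in `[t, +oo[) (expR (- (beta * T)))%:E)%E.
    rewrite -ge0_integralZl//; last 2 first.
    - exact/measurable_EFinP.
    - by rewrite lee_fin g0.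
    rewrite [RHS]integral_mkcond; apply: eq_integral => T _; rewrite patchE /K /k indicE /=.
    have gDt : gD t = g t by rewrite /gD patchE mem_set//= in_itv /= t0.
    case: ifPn => [/set_mem /=|tT].
      rewrite in_itv /= andbT => tT; rewrite mem_set /tri /= ?t0//.
      by rewrite mul1r gDt -EFinM mulrC.
    rewrite memNset ?mul0r ?mulr0// => /= /andP[_ H]; move/negP: tT; apply.
    by rewrite mem_set//= in_itv /= H.
  rewrite integral_exp_tail -!EFinM; congr EFin.
  by field; rewrite lt0r_neq0.
rewrite notin_setE /= in_itv /= andbT => /negP; rewrite -ltNge => t0.
rewrite integral0_eq ?mule0// => T _; rewrite /K /k indicE memNset ?mul0r ?mulr0//.
by rewrite /tri /= leNgt t0.
Qed.

End discounting.

(** The integrals of [c] and [e] may be infinite: the negative part of [h] is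
    moved to the side of [c] before integrating, so that only nonnegative
    functions are added. *)
Lemma ge0_integral_perturb (R : realType) (d : measure_display)
    (T : measurableType d) (mu : {measure set T -> \bar R}) (D : set T)
    (c e h : T -> R) :
  measurable D -> measurable_fun D c -> measurable_fun D e ->
  (forall t, D t -> 0 <= c t) -> (forall t, D t -> 0 <= e t) ->
  mu.-integrable D (EFin \o h) -> (forall t, D t -> c t = e t + h t) ->
  (\int[mu]_(t in D) (c t)%:E =
   \int[mu]_(t in D) (e t)%:E + (\int[mu]_(t in D) h t)%:E)%E.
Proof.
move=> mD mc me c0 e0 ih ceh.
have mh : measurable_fun D (EFin \o h) := measurable_int _ ih.
have fN : (\int[mu]_(t in D) ((EFin \o h)^\- t) \is a fin_num)%E.
  exact: integrable_neg_fin_num.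
have fP : (\int[mu]_(t in D) ((EFin \o h)^\+ t) \is a fin_num)%E.
  exact: integrable_pos_fin_num.
have mcE : measurable_fun D (EFin \o c) by exact/measurable_EFinP.
have meE : measurable_fun D (EFin \o e) by exact/measurable_EFinP.
have : (\int[mu]_(t in D) ((c t)%:E + (EFin \o h)^\- t) =
        \int[mu]_(t in D) ((e t)%:E + (EFin \o h)^\+ t))%E.
  apply: eq_integral => t /set_mem Dt; rewrite (ceh _ Dt) EFinD -addeA.
  congr (_ + _)%E; rewrite funeposE funenegE /= -!EFin_max -EFinD.
  by congr (_%:E); rewrite /Num.max; case: ltP => ?; case: ltP => ?; lra.
rewrite !ge0_integralD//; last 2 first.
- exact: measurable_funepos.
- exact: measurable_funeneg.
move=> E; rewrite fineK; last exact: integrable_fin_num.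
rewrite [X in (_ + X)%E]integralE addeA -E addeK//.
Qed.

Lemma measurable_fun_half_line (R : realType) (f : R -> R) :
  (forall T : R, 0 <= T -> measurable_fun (`[0, T] : set (measurableTypeR R)) f) ->
  measurable_fun (`[0, +oo[ : set (measurableTypeR R)) f.
Proof.
move=> mf; have -> : `[0, +oo[%classic = \bigcup_n `[0, n%:R : R]%classic.
  apply/seteqP; split=> [t /=|t [n _] /=]; rewrite !in_itv /= ?andbT.
    move=> t0; exists (Num.truncn t).+1 => //=; rewrite in_itv /= t0 ltW//.
    by rewrite truncnS_gt.
  by case/andP.
by apply/measurable_fun_bigcup => // n; exact: mf.
Qed.

Section discounted_balance.
Context (R : realType) (beta : R).
Hypothesis beta_gt0 : 0 < beta.
Let mu := @lebesgue_measure R.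

Definition discounted_integral (f : R -> R) : \bar R :=
  (\int[mu]_(t in `[0%R, +oo[) (expR (- (beta * t)) * f t)%:E)%E.

Let HL : set (measurableTypeR R) := `[0, +oo[%classic.

Lemma measurable_discount (D : set (measurableTypeR R)) :
  measurable_fun D (fun t => expR (- (beta * t))).
Proof.
apply: measurable_funTS; apply: measurableT_comp; first exact: measurable_expR.
by apply: measurable_funN; exact: mulrl_measurable.
Qed.

Lemma discounted_integral_ge0 (f : R -> R) :
  (forall t, 0 <= t -> 0 <= f t) -> (0 <= discounted_integral f)%E.
Proof.
move=> f0; apply: integral_ge0 => t; rewrite /= in_itv /= andbT => t0.
by rewrite lee_fin mulr_ge0 ?expR_ge0 ?f0.
Qed.

Lemma discounted_integralD (f g : R -> R) :
  measurable_fun HL f -> measurable_fun HL g ->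
  (forall t, 0 <= t -> 0 <= f t) -> (forall t, 0 <= t -> 0 <= g t) ->
  discounted_integral (fun t => f t + g t) =
  (discounted_integral f + discounted_integral g)%E.
Proof.
move=> mf mg f0 g0; rewrite /discounted_integral -ge0_integralD//.
- by apply: eq_integral => t _; rewrite mulrDr EFinD.
- by move=> t; rewrite /= in_itv /= andbT => t0; rewrite lee_fin mulr_ge0 ?expR_ge0 ?f0.
- by apply/measurable_EFinP/measurable_funM => //; exact: measurable_discount.
- by move=> t; rewrite /= in_itv /= andbT => t0; rewrite lee_fin mulr_ge0 ?expR_ge0 ?g0.
- by apply/measurable_EFinP/measurable_funM => //; exact: measurable_discount.
Qed.

Lemma discounted_integralZl (k : R) (f : R -> R) : 0 <= k ->
  measurable_fun HL f -> (forall t, 0 <= t -> 0 <= f t) ->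
  discounted_integral (fun t => k * f t) = (k%:E * discounted_integral f)%E.
Proof.
move=> k0 mf f0; rewrite /discounted_integral -ge0_integralZl//.
- by apply: eq_integral => t _; rewrite -EFinM mulrCA.
- by apply/measurable_EFinP/measurable_funM => //; exact: measurable_discount.
- by move=> t; rewrite /= in_itv /= andbT => t0; rewrite lee_fin mulr_ge0 ?expR_ge0 ?f0.
Qed.

Lemma discounted_integral_cst (k : R) : 0 <= k ->
  discounted_integral (fun=> k) = (k / beta)%:E.
Proof.
move=> k0; transitivity (discounted_integral (fun=> k * 1)).
  by rewrite /discounted_integral; apply: eq_integral => t _; rewrite mulr1.
rewrite discounted_integralZl// /discounted_integral.
under eq_integral do rewrite mulr1.
by rewrite integral_exp_tail// mulr0 oppr0 expR0 mulr1.
Qed.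

Lemma le_discounted_integral (f g : R -> R) :
  measurable_fun HL f -> measurable_fun HL g ->
  (forall t, 0 <= t -> 0 <= f t <= g t) ->
  (discounted_integral f <= discounted_integral g)%E.
Proof.
move=> mf mg fg; apply: ge0_le_integral => //.
- move=> t; rewrite /= in_itv /= andbT => t0.
  by have /andP[? _] := fg _ t0; rewrite lee_fin mulr_ge0 ?expR_ge0.
- by apply/measurable_EFinP/measurable_funM => //; exact: measurable_discount.
- by apply/measurable_EFinP/measurable_funM => //; exact: measurable_discount.
- move=> t; rewrite /= in_itv /= andbT => t0.
  by have /andP[_ ?] := fg _ t0; rewrite lee_fin ler_wpM2l ?expR_ge0.
Qed.

(** The discounted form of a balance that holds on every finite horizon: multiply
    it by [beta exp (- beta T)], integrate in [T], and recognise the discounted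
    integrals of [c] and [e]. *)
Lemma discounted_balance (c e w : R -> R) :
  measurable_fun HL c -> measurable_fun HL e -> measurable_fun HL w ->
  (forall t, 0 <= t -> 0 <= c t) -> (forall t, 0 <= t -> 0 <= e t) ->
  (forall t, 0 <= t -> 0 <= w t) ->
  (forall T : R, 0 <= T ->
     (\int[mu]_(t in `[0%R, T]) (c t)%:E + (w T)%:E =
      \int[mu]_(t in `[0%R, T]) (e t)%:E + (w 0)%:E)%E) ->
  (discounted_integral c + beta%:E * discounted_integral w =
   discounted_integral e + (w 0)%:E)%E.
Proof.
move=> mc me mw c0 e0 w0 bal.
have w00 : 0 <= w 0 by exact: w0.
have -> : (w 0)%:E = (beta%:E * discounted_integral (fun=> w 0%R))%E.
  by rewrite discounted_integral_cst// -EFinM mulrC divfK ?lt0r_neq0.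
rewrite /discounted_integral (discounted_running_integral beta_gt0 mc c0).
rewrite (discounted_running_integral beta_gt0 me e0).
pose C f T := (\int[mu]_(t in `[0%R, T]) (f t)%:E)%E.
have C0 (f : R -> R) T : (forall t, 0 <= t -> 0 <= f t) -> (0 <= C f T)%E.
  move=> f0; apply: integral_ge0 => t; rewrite /= in_itv /= => /andP[t0 _].
  by rewrite lee_fin f0.
have mC (f : R -> R) : measurable_fun HL f -> (forall t, 0 <= t -> 0 <= f t) ->
    measurable_fun HL (fun T => (expR (- (beta * T)))%:E * C f T)%E.
  move=> mf f0; apply: emeasurable_funM.
    by apply/measurable_EFinP; exact: measurable_discount.
  exact: measurable_running_integral.
have mE (f : R -> R) : measurable_fun HL f ->
    measurable_fun HL (fun T => (expR (- (beta * T)) * f T)%:E).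
  by move=> mf; apply/measurable_EFinP/measurable_funM => //; exact: measurable_discount.
have E0 T (x : \bar R) : (0 <= x)%E -> (0 <= (expR (- (beta * T)))%:E * x)%E.
  by move=> x0; rewrite mule_ge0// lee_fin expR_ge0.
have I0 (f : R -> R) : (forall t, 0 <= t -> 0 <= f t) ->
    (0 <= \int[mu]_(T in HL) ((expR (- (beta * T)))%:E * C f T))%E.
  by move=> f0; apply: integral_ge0 => T _; exact/E0/C0.
rewrite -!ge0_muleDr ?I0 ?discounted_integral_ge0//; congr (_ * _)%E.
rewrite /discounted_integral -!ge0_integralD//; first last.
all: try (by move=> T _; exact/E0/C0).
all: try exact: mC.
all: try exact: mE.
all: try (move=> T; rewrite /= in_itv /= andbT => T0; rewrite lee_fin mulr_ge0 ?expR_ge0 ?w0//).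
apply: eq_integral => T; rewrite inE /= in_itv /= andbT => T0.
by rewrite !EFinM -!ge0_muleDr ?C0 ?lee_fin ?w0// bal.
Qed.

End discounted_balance.

(** * Gronwall's lemma by discounting *)

Section finite_horizon.
Context (R : realType) (beta : R).
Hypothesis beta_gt0 : 0 < beta.
Let mu := @lebesgue_measure R.
Let HL : set (measurableTypeR R) := `[0, +oo[%classic.

(** The discount factor is at least [exp (- beta T)] up to time [T]. *)
Lemma integral_le_discounted (f : R -> R) (T : R) : 0 <= T ->
  measurable_fun HL f -> (forall t, 0 <= t -> 0 <= f t) ->
  (\int[mu]_(t in `[0%R, T]) (f t)%:E <=
   (expR (beta * T))%:E * discounted_integral beta f)%E.
Proof.
move=> T0 mf f0.
have sub : `[0, T] `<=` HL.
  by move=> t /=; rewrite /HL /= !in_itv /= => /andP[->].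
have mef : measurable_fun HL (fun t => (expR (- (beta * t)) * f t)%:E).
  by apply/measurable_EFinP/measurable_funM => //; exact: measurable_discount.
have ef0 t : HL t -> (0 <= (expR (- (beta * t)) * f t)%:E)%E.
  by rewrite /HL /= in_itv /= andbT => t0; rewrite lee_fin mulr_ge0 ?expR_ge0 ?f0.
rewrite -ge0_integralZl ?lee_fin ?expR_ge0//.
apply: (@le_trans _ _ (\int[mu]_(t in `[0%R, T])
   ((expR (beta * T))%:E * (expR (- (beta * t)) * f t)%:E))%E).
  apply: ge0_le_integral => //.
  - by move=> t /sub; rewrite /HL /= in_itv /= andbT => t0; rewrite lee_fin f0.
  - by apply/measurable_EFinP; exact: (measurable_funS (measurable_itv _) sub mf).
  - by apply: measurable_funeM; exact: (measurable_funS (measurable_itv _) sub mef).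
  - move=> t; rewrite /= in_itv /= => /andP[t0 tT].
    rewrite -EFinM lee_fin mulrA -expRD ler_peMl ?f0//.
    by rewrite -expR0 ler_expR subr_ge0 ler_pM2l.
apply: ge0_subset_integral => //.
- exact: measurable_funeM.
- by move=> t Ht; rewrite mule_ge0 ?lee_fin ?expR_ge0 ?ef0// -lee_fin ef0.
Qed.

End finite_horizon.

(** Gronwall's lemma with zero initial value. Discounting the inequality at rate
    [2 K] bounds the discounted integral of [w] by half of itself; it is finite
    since [w] is bounded, hence it vanishes. *)
Lemma gronwall_zero (R : realType) (K M : R) (w : R -> R) :
  0 < K -> measurable_fun (`[0, +oo[ : set (measurableTypeR R)) w ->
  (forall t, 0 <= t -> 0 <= w t <= M) ->
  (forall T : R, 0 <= T -> ((w T)%:E <= K%:E *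
     \int[@lebesgue_measure R]_(t in `[0%R, T]) (w t)%:E)%E) ->
  forall t, 0 <= t -> w t = 0.
Proof.
move=> K0 mw wM gron t t0.
have w0 s : 0 <= s -> 0 <= w s by move=> /wM /andP[].
have M0 : 0 <= M by have /andP[? /(le_trans _)->] := wM 0 (lexx 0).
(* Any rate above K would do: the bound below is K over the rate. *)
have b0 : 0 < 2 * K by rewrite mulr_gt0.
have Lfin : discounted_integral (2 * K) w \is a fin_num.
  rewrite ge0_fin_numE ?discounted_integral_ge0//.
  apply: (@le_lt_trans _ _ (discounted_integral (2 * K) (fun=> M))).
    exact: le_discounted_integral.
  by rewrite discounted_integral_cst// ltry.
have /fineK EL := Lfin; set L := fine _ in EL.
have L0 : L = 0.
  apply/eqP; rewrite eq_le fine_ge0 ?discounted_integral_ge0// andbT.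
  suff : L <= 2^-1 * L by lra.
  rewrite -lee_fin EFinM EL.
  apply: (@le_trans _ _ (K%:E * ((2 * K)^-1%:E * discounted_integral (2 * K) w))%E).
    rewrite [in leRHS]/discounted_integral (discounted_running_integral b0 mw w0).
    rewrite [X in (K%:E * X)%E]muleA -EFinM mulVf ?lt0r_neq0// mul1e.
    rewrite -ge0_integralZl//; last 3 first.
    - apply: emeasurable_funM.
        by apply/measurable_EFinP; exact: measurable_discount.
      exact: measurable_running_integral.
    - move=> T; rewrite /= in_itv /= andbT => T0.
      rewrite mule_ge0 ?lee_fin ?expR_ge0//; apply: integral_ge0 => s.
      by rewrite /= in_itv /= => /andP[s0 _]; rewrite lee_fin w0.
    - by rewrite lee_fin ltW.
    apply: ge0_le_integral => //.
    - move=> T; rewrite /= in_itv /= andbT => T0.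
      by rewrite lee_fin mulr_ge0 ?expR_ge0 ?w0.
    - by apply/measurable_EFinP/measurable_funM => //; exact: measurable_discount.
    - apply: measurable_funeM; apply: emeasurable_funM.
        by apply/measurable_EFinP; exact: measurable_discount.
      exact: measurable_running_integral.
    - move=> T; rewrite /= in_itv /= andbT => T0.
      by rewrite muleCA EFinM lee_wpmul2l ?lee_fin ?expR_ge0// gron.
  rewrite -EL -!EFinM lee_fin le_eqVlt; apply/orP; left; apply/eqP.
  by field; rewrite lt0r_neq0.
apply/eqP; rewrite eq_le w0// andbT -lee_fin (le_trans (gron t t0))//.
have := @integral_le_discounted R (2 * K) b0 w t t0 mw w0.
rewrite -EL L0 mule0 => I0.
by apply: le_trans (lee_wpmul2l _ I0) _; [rewrite lee_fin ltW|rewrite mule0].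
Qed.

(** * Verification for the deterministic control problem *)

Section constant_on_interval.
Context (R : realType).
Let mu := @lebesgue_measure R.

Lemma integrable_cst_itv (k T : R) : mu.-integrable `[0, T] (EFin \o cst k).
Proof.
apply: measurable_bounded_integrable => //.
  by rewrite /mu /= lebesgue_measure_itv; case: ifP => _ //=; rewrite -EFinB ltry.
by exists `|k|; split; [exact: num_real|move=> M kM t _ /=; exact: ltW].
Qed.

Lemma Rintegral_cst_itv (k T : R) : 0 <= T -> \int[mu]_(t in `[0, T]) k = k * T.
Proof.
move=> T0; rewrite Rintegral_cst//; congr (_ * _).
rewrite /mu /= lebesgue_measure_itv/= lte_fin; case: ltP => [_|T0'] /=; rewrite ?subr0//.
by apply/eqP; rewrite eq_le T0.
Qed.

End constant_on_interval.

Section controlled_flow.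
Context (R : realType) (sigma beta kappa p D : R).
Let mu := @lebesgue_measure R.
Let HL : set (measurableTypeR R) := `[0, +oo[%classic.

(** The minimizer over [b >= 0] of the Hamiltonian in the state [y], when [D] is
    the value of the state 1 minus the value of the state 0. *)
Definition feedback (y : bool) : R := if y then Num.max D 0 else Num.max (- D) 0.

(** How much the rate [b] exceeds the minimum of the Hamiltonian in the state
    [y], the minimum being [- feedback y ^+ 2 / 2]. *)
Definition gap (y : bool) (b : R) : R :=
  2^-1 * b ^+ 2 + (if y then - (b * D) else b * D) + 2^-1 * feedback y ^+ 2.

Definition state_mean (m : R -> R) (f : R -> bool -> R) (t : R) : R :=
  (1 - m t) * f t false + m t * f t true.

Definition mean_cost (m : R -> R) (b : control R) : R -> R :=
  state_mean m (running_cost kappa (fun=> p) b).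

Definition mean_gap (m : R -> R) (b : control R) : R -> R :=
  state_mean m (fun t y => gap y (b t y)).

Definition drift (m : R -> R) (b : control R) (t : R) : R :=
  (1 - m t) * (sigma ^+ 2 + b t false) - m t * (sigma ^+ 2 + b t true).

(** With [u] the value function in the state 0, this is the right-hand side of
    the Hamilton-Jacobi-Bellman equation [beta * u = base_value]; for [beta = 0]
    it is the optimal ergodic cost. *)
Definition base_value : R :=
  kappa * p + sigma ^+ 2 * D - 2^-1 * feedback false ^+ 2.

(** The difference of the Hamilton-Jacobi-Bellman equations of the states 1 and
    0; the constant flow [p] being given, it determines [D]. *)
Definition hjb : Prop :=
  beta * D = kappa * (1 - 2 * p) - 2 * sigma ^+ 2 * D
             - 2^-1 * feedback true ^+ 2 + 2^-1 * feedback false ^+ 2.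

(** [m] is the probability of the state 1 for the chain controlled by [b],
    described by the forward equation alone. *)
Definition controlled_flow (m : R -> R) (b : control R) : Prop :=
  [/\ measurable_fun HL m, (forall t, 0 <= t -> 0 <= m t <= 1), admissible b &
      forall T, 0 <= T -> m T = m 0 + \int[mu]_(t in `[0, T]) drift m b t].

Lemma feedback_ge0 y : 0 <= feedback y.
Proof. by rewrite /feedback; case: y; rewrite le_max lexx orbT. Qed.

(** Strong convexity of the Hamiltonian; the constraint [0 <= b] enters in the
    state where the unconstrained minimizer is negative. *)
Lemma gap_ge_sqr y b : 0 <= b -> 2^-1 * (b - feedback y) ^+ 2 <= gap y b.
Proof.
move=> b0; rewrite /gap /feedback; case: y; rewrite /Num.max; case: ltP => hD; nra.
Qed.

Lemma gap_ge0 y b : 0 <= b -> 0 <= gap y b.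
Proof.
by move=> b0; rewrite (le_trans _ (gap_ge_sqr y b0))// mulr_ge0// sqr_ge0.
Qed.

Lemma gap_feedback y : gap y (feedback y) = 0.
Proof.
by rewrite /gap /feedback; case: y; rewrite /Num.max; case: ltP => hD; field.
Qed.

(** The verification identity. The value function is affine in the law [m], with
    slope [D]; along any controlled flow the running cost is [beta] times this
    value, plus the nonnegative gap, minus the drift of the value. *)
Lemma mean_cost_decomposition (m : R -> R) (b : control R) (t : R) : hjb ->
  mean_cost m b t =
  mean_gap m b t + (base_value + beta * (D * m t) - D * drift m b t).
Proof.
move=> H; have -> : beta * (D * m t) = m t * (beta * D) by ring.
rewrite H /mean_cost /mean_gap /state_mean /running_cost /ell /gap /base_value.
by rewrite /drift; field.
Qed.

Section flow.
Context (m : R -> R) (b : control R).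
Hypothesis kappa_ge0 : 0 <= kappa.
Hypothesis p01 : 0 <= p <= 1.
Hypothesis flow_mb : controlled_flow m b.

Let mm : measurable_fun HL m. Proof. by case: flow_mb. Qed.
Let m0 t : 0 <= t -> 0 <= m t.
Proof. by case: flow_mb => _ + _ _ => /[apply] /andP[]. Qed.
Let m1 t : 0 <= t -> 0 <= 1 - m t.
Proof. by case: flow_mb => _ + _ _ => /[apply] /andP[_]; rewrite subr_ge0. Qed.
Let b0 t y : 0 <= t -> 0 <= b t y.
Proof. by case: flow_mb => _ _ [+ _] _; apply. Qed.
Let ib y T : 0 <= T -> mu.-integrable `[0, T] (EFin \o (b ^~ y)).
Proof. by case: flow_mb => _ _ [_ +] _; exact. Qed.
Let mb y : measurable_fun HL (b ^~ y).
Proof.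
apply: measurable_fun_half_line => T T0.
by apply/measurable_EFinP; exact: (measurable_int _ (ib y T0)).
Qed.

Let measurable_state_mean (f : R -> bool -> R) :
  (forall y, measurable_fun HL (f ^~ y)) -> measurable_fun HL (state_mean m f).
Proof.
move=> mf; apply: measurable_funD; apply: measurable_funM => //.
exact: measurable_funB.
Qed.

Let state_mean_ge0 (f : R -> bool -> R) t : 0 <= t ->
  (forall y, 0 <= f t y) -> 0 <= state_mean m f t.
Proof. by move=> t0 f0; rewrite addr_ge0// mulr_ge0 ?m0 ?m1. Qed.

Lemma measurable_running_cost y :
  measurable_fun HL (fun t => running_cost kappa (fun=> p) b t y).
Proof.
apply: measurable_funD => //; apply: measurable_funM => //.
exact: measurable_funX.
Qed.

Lemma running_cost_ge0 t y : 0 <= t -> 0 <= running_cost kappa (fun=> p) b t y.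
Proof.
move=> t0; have /andP[? ?] := p01.
rewrite addr_ge0// mulr_ge0// ?sqr_ge0//.
by rewrite /ell; case: y => //; rewrite subr_ge0.
Qed.

Lemma measurable_mean_cost : measurable_fun HL (mean_cost m b).
Proof. by apply: measurable_state_mean => y; exact: measurable_running_cost. Qed.

Lemma mean_cost_ge0 t : 0 <= t -> 0 <= mean_cost m b t.
Proof. by move=> t0; apply: state_mean_ge0 => // y; exact: running_cost_ge0. Qed.

Lemma measurable_mean_gap : measurable_fun HL (mean_gap m b).
Proof.
apply: measurable_state_mean => y; apply: measurable_funD => //.
apply: measurable_funD.
  by apply: measurable_funM => //; exact: measurable_funX.
case: y; last exact: measurable_funM.
by apply: measurable_funN; exact: measurable_funM.
Qed.

Lemma mean_gap_ge0 t : 0 <= t -> 0 <= mean_gap m b t.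
Proof.
by move=> t0; apply: state_mean_ge0 => // y; apply: gap_ge0; exact: b0.
Qed.

Let subHL T : `[0, T]%classic `<=` HL.
Proof. by move=> t; rewrite /HL /= !in_itv /= => /andP[->]. Qed.

Let mS T (f : R -> R) : measurable_fun HL f ->
  measurable_fun (`[0, T] : set (measurableTypeR R)) f.
Proof. by move=> mf; exact: (measurable_funS (measurable_itv _) (@subHL T) mf). Qed.

Lemma integrable_drift T : 0 <= T -> mu.-integrable `[0, T] (EFin \o drift m b).
Proof.
move=> T0.
have ic (k : R) := integrable_cst_itv k T.
have ir y : mu.-integrable `[0, T] (EFin \o (fun t => sigma ^+ 2 + b t y)).
  exact: (integrableD _ (ic _) (ib y T0)).
have i0 : mu.-integrable `[0, T]
    (EFin \o (fun t => (1 - m t) * (sigma ^+ 2 + b t false))).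
  apply: (@integrable_bounded_mul _ _ 1) => //.
  - by apply: mS; exact: measurable_funB.
  - move=> t /subHL; rewrite /HL /= in_itv /= andbT => t0.
    by rewrite ger0_norm ?m1// lerBlDr lerDl m0.
have i1 : mu.-integrable `[0, T]
    (EFin \o (fun t => m t * (sigma ^+ 2 + b t true))).
  apply: (@integrable_bounded_mul _ _ 1) => //.
  - exact: mS.
  - move=> t /subHL; rewrite /HL /= in_itv /= andbT => t0.
    by rewrite ger0_norm ?m0// -subr_ge0 m1.
exact: (integrableB _ i0 i1).
Qed.

Let int_drift T : 0 <= T -> \int[mu]_(t in `[0, T]) drift m b t = m T - m 0.
Proof. by move=> T0; case: flow_mb => _ _ _ /(_ _ T0) ->; rewrite addrC addKr. Qed.

(** The cost is the value function at the initial law plus the discounted gap.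
    This is the verification identity discounted, with constants added to make
    both sides nonnegative. *)
Lemma discounted_mean_cost : 0 < beta -> hjb ->
  discounted_integral beta (mean_cost m b) =
  (discounted_integral beta (mean_gap m b) +
   (base_value / beta + D * m 0%R)%:E)%E.
Proof.
move=> beta_gt0 H; have bneq0 := lt0r_neq0 beta_gt0.
set u := base_value / beta; have uE : base_value = beta * u by rewrite /u; field.
(* K makes w nonnegative; N is then forced by beta * (u + D * m t) + N =
   beta * w t, which puts the value function into the form of the balance. *)
pose K := `|D| + `|u|; pose w t := K + D * m t; pose N := beta * (K - u).
have w0 t : 0 <= t -> 0 <= w t.
  move=> t0; rewrite /w /K addrAC addr_ge0//.
  have : `|D * m t| <= `|D|.
    by rewrite normrM ler_piMr// ger0_norm ?m0// -subr_ge0 m1.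
  by rewrite ler_norml => /andP[]; lra.
have wK t : 0 <= t -> w t <= K + `|D|.
  move=> t0; rewrite /w lerD2l (le_trans (ler_norm _))//.
  by rewrite normrM ler_piMr// ger0_norm ?m0// -subr_ge0 m1.
have mw : measurable_fun HL w by apply: measurable_funD => //; exact: measurable_funM.
have N0 : 0 <= N.
  by rewrite /N mulr_ge0 ?(ltW beta_gt0)// subr_ge0 /K (le_trans (ler_norm u))// lerDr.
have mc := measurable_mean_cost; have me := measurable_mean_gap.
have bw0 t : 0 <= t -> 0 <= beta * w t by move=> t0; rewrite mulr_ge0 ?w0// (ltW beta_gt0).
have mbw : measurable_fun HL (fun t => beta * w t) by exact: measurable_funM.
have c1m : measurable_fun HL (fun t => mean_cost m b t + N) by exact: measurable_funD.
have e1m : measurable_fun HL (fun t => mean_gap m b t + beta * w t).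
  exact: measurable_funD.
have c10 t : 0 <= t -> 0 <= mean_cost m b t + N.
  by move=> t0; rewrite addr_ge0 ?mean_cost_ge0.
have e10 t : 0 <= t -> 0 <= mean_gap m b t + beta * w t.
  by move=> t0; rewrite addr_ge0 ?mean_gap_ge0 ?bw0.
have bal T : 0 <= T ->
    (\int[mu]_(t in `[0%R, T]) (mean_cost m b t + N)%:E + (w T)%:E =
     \int[mu]_(t in `[0%R, T]) (mean_gap m b t + beta * w t)%:E + (w 0%R)%:E)%E.
  move=> T0; have iD := integrable_drift T0.
  have iDd : mu.-integrable `[0, T] (EFin \o (fun t => - D * drift m b t)).
    exact: (integrableZl _ (- D) iD).
  rewrite (@ge0_integral_perturb _ _ _ mu _ _ _ _ (measurable_itv _) (mS c1m) (mS e1m) _ _ iDd)//.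
  - rewrite RintegralZl// int_drift// -addeA -EFinD; congr (_ + _%:E)%E.
    by rewrite /w; ring.
  - by move=> t /subHL; rewrite /HL /= in_itv /= andbT; exact: c10.
  - by move=> t /subHL; rewrite /HL /= in_itv /= andbT; exact: e10.
  - by move=> t _; rewrite mean_cost_decomposition// uE /N /w; ring.
have := discounted_balance beta_gt0 c1m e1m mw c10 e10 w0 bal.
rewrite (discounted_integralD beta mc (measurable_cst N) mean_cost_ge0)//.
rewrite (discounted_integralD beta me mbw mean_gap_ge0 bw0).
rewrite (discounted_integral_cst beta_gt0 N0).
rewrite (discounted_integralZl beta (ltW beta_gt0) mw w0).
have Lfin : (beta%:E * discounted_integral beta w)%E \is a fin_num.
  rewrite fin_numM// ge0_fin_numE ?discounted_integral_ge0//.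
  apply: (@le_lt_trans _ _ (discounted_integral beta (fun=> K + `|D|))).
    by apply: le_discounted_integral => // t t0; rewrite w0 ?wK.
  by rewrite discounted_integral_cst ?ltry// addr_ge0// addr_ge0.
have /fineK <- := Lfin; set x := fine _.
move: (discounted_integral beta (mean_cost m b)) => C.
move: (discounted_integral beta (mean_gap m b)) => G; rewrite -!addeA -!EFinD => E.
rewrite -[LHS](@addeK _ (N / beta + x)%:E)// E -addeA -EFinB; congr (_ + _%:E)%E.
by rewrite /N /w; field.
Qed.

(** Over a finite horizon the drift of the value function integrates to a bounded
    term, which disappears in long time averages. *)
Lemma undiscounted_mean_cost T : beta = 0 -> hjb -> 0 <= T ->
  (\int[mu]_(t in `[0%R, T]) (mean_cost m b t)%:E =
   \int[mu]_(t in `[0%R, T]) (mean_gap m b t)%:E +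
   (base_value * T - D * (m T - m 0%R))%:E)%E.
Proof.
move=> beta0 H T0.
have iD := integrable_drift T0.
have iDd : mu.-integrable `[0, T] (EFin \o (fun t => D * drift m b t)).
  exact: (integrableZl _ D iD).
have ih : mu.-integrable `[0, T] (EFin \o (fun t => base_value - D * drift m b t)).
  exact: (integrableB _ (integrable_cst_itv base_value T) iDd).
rewrite (@ge0_integral_perturb _ _ _ mu _ _ _ _ (measurable_itv _) (mS measurable_mean_cost)
  (mS measurable_mean_gap) _ _ ih)//.
- congr (_ + _%:E)%E; rewrite RintegralB//; last exact: integrable_cst_itv.
  by rewrite RintegralZl// int_drift// Rintegral_cst_itv.
- by move=> t /subHL; rewrite /HL /= in_itv /= andbT; exact: mean_cost_ge0.
- by move=> t /subHL; rewrite /HL /= in_itv /= andbT; exact: mean_gap_ge0.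
- by move=> t _; rewrite mean_cost_decomposition// beta0; ring.
Qed.

End flow.
End controlled_flow.

(** * Constant flows *)

Lemma mean_gap_feedback (R : realType) (D : R) (m : R -> R) (t : R) :
  mean_gap D m (fun=> feedback D) t = 0.
Proof. by rewrite /mean_gap /state_mean !gap_feedback !mulr0 addr0. Qed.

Lemma admissible_feedback (R : realType) (D : R) :
  admissible (fun=> feedback D).
Proof.
split=> [t y _|y T T0]; first exact: feedback_ge0.
exact: integrable_cst_itv.
Qed.

(** The law [p] is invariant for the chain controlled by the optimal feedback. *)
Definition balanced (R : realType) (sigma p D : R) : Prop :=
  (1 - p) * (sigma ^+ 2 + feedback D false) =
  p * (sigma ^+ 2 + feedback D true).

Section constant_flow.
Context (R : realType) (sigma p D : R) (m : R -> R) (b : control R).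
Let mu := @lebesgue_measure R.
Hypothesis p01 : 0 <= p <= 1.
Hypothesis flow_mb : controlled_flow sigma m b.

Let b0 t y : 0 <= t -> 0 <= b t y.
Proof. by case: flow_mb => _ _ [+ _] _; apply. Qed.

(** The integrated drift vanishes along a constant flow. By strong convexity the
    gap dominates the squared distance between [b] and the optimal feedback, and
    Young's inequality turns a small mean gap into a small difference between
    their mean drifts. A single horizon for each [eps] suffices, which covers
    the discounted and the ergodic problem at once. *)
Lemma balanced_of_small_gap :
  (forall t, 0 <= t -> m t = p) ->
  (forall eps, 0 < eps -> exists2 T, 0 < T &
     (\int[mu]_(t in `[0%R, T]) (mean_gap D m b t)%:E <= (eps * T)%:E)%E) ->
  balanced sigma p D.
Proof.
move=> mp small; pose x := (1 - p) * (sigma ^+ 2 + feedback D false) -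
  p * (sigma ^+ 2 + feedback D true).
(* s stands for a sign, so that both bounds on x are proved at once. *)
suff sx s delta : s ^+ 2 = 1 -> 0 < delta -> s * x <= delta.
  have x0 : x <= 0.
    by apply/ler_addgt0Pr => e e0; rewrite add0r -[x]mul1r sx// expr1n.
  have x0' : - x <= 0.
    by apply/ler_addgt0Pr => e e0; rewrite add0r -[x]mul1r -mulNr sx// sqrrN expr1n.
  by rewrite /balanced; rewrite /x in x0 x0'; lra.
(* Young's inequality in the form y <= delta / 2 + y ^+ 2 / (2 * delta) costs
   delta / 2 and divides the gap by delta, whence this choice of eps. *)
move=> s2 delta0; have e0 : 0 < delta ^+ 2 / 2 by rewrite divr_gt0// exprn_gt0.
have [T T0 gapT] := small _ e0.
have sub t : `[0, T]%classic t -> 0 <= t by rewrite /= in_itv /= => /andP[].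
have mg : measurable_fun (`[0, T] : set (measurableTypeR R)) (mean_gap D m b).
  apply: measurable_funS (measurable_mean_gap D flow_mb) => //.
  by move=> t /=; rewrite !in_itv /= => /andP[->].
have g0 t : `[0, T]%classic t -> 0 <= mean_gap D m b t.
  by move=> /sub; exact: (mean_gap_ge0 D flow_mb).
have ig : mu.-integrable `[0, T] (EFin \o mean_gap D m b).
  apply/integrableP; split; first exact/measurable_EFinP.
  under eq_integral => t Ht do rewrite /= ger0_norm ?(g0 _ (set_mem Ht))//.
  exact: le_lt_trans gapT (ltry _).
have idr := integrable_drift flow_mb (ltW T0).
have i1 : mu.-integrable `[0, T] (EFin \o (fun t => s * drift sigma m b t)).
  exact: (integrableZl _ s idr).
have i2 : mu.-integrable `[0, T] (EFin \o (fun t => delta^-1 * mean_gap D m b t)).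
  exact: (integrableZl _ delta^-1 ig).
have i3 : mu.-integrable `[0, T]
    (EFin \o (fun t => s * drift sigma m b t + delta^-1 * mean_gap D m b t)).
  exact: (integrableD _ i1 i2).
have i4 : mu.-integrable `[0, T] (EFin \o (fun t => s * drift sigma m b t +
    delta^-1 * mean_gap D m b t + delta / 2)).
  exact: (integrableD _ i3 (integrable_cst_itv (delta / 2) T)).
have : \int[mu]_(t in `[0, T]) (s * x) <= \int[mu]_(t in `[0, T])
    (s * drift sigma m b t + delta^-1 * mean_gap D m b t + delta / 2).
  apply: le_Rintegral => //; first exact: integrable_cst_itv.
  move=> t /sub t0.
  have h0 := gap_ge_sqr D false (b0 false t0).
  have h1 := gap_ge_sqr D true (b0 true t0).
  have /andP[p0 p1] := p01.
  have h : (1 - p) * (2^-1 * (b t false - feedback D false) ^+ 2) +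
           p * (2^-1 * (b t true - feedback D true) ^+ 2) <= mean_gap D m b t.
    by rewrite /mean_gap /state_mean mp// lerD// ler_wpM2l// subr_ge0.
  have {h} h : delta^-1 * ((1 - p) * (2^-1 * (b t false - feedback D false) ^+ 2) +
           p * (2^-1 * (b t true - feedback D true) ^+ 2)) <= delta^-1 * mean_gap D m b t.
    by rewrite ler_pM2l ?invr_gt0.
  apply: (@le_trans _ _ (s * drift sigma m b t + delta^-1 *
    ((1 - p) * (2^-1 * (b t false - feedback D false) ^+ 2) +
     p * (2^-1 * (b t true - feedback D true) ^+ 2)) + delta / 2)); last first.
    by rewrite lerD2r lerD2l.
  rewrite -subr_ge0 /drift mp// /x.
  (* Completing the squares in Young's inequality, state by state. *)
  rewrite [leRHS](_ : _ = (2 * delta)^-1 *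
    ((1 - p) * (b t false - feedback D false + s * delta) ^+ 2 +
     p * (b t true - feedback D true - s * delta) ^+ 2)); last first.
    have -> : delta / 2 = s ^+ 2 * delta / 2 by rewrite s2 mul1r.
    by field; rewrite lt0r_neq0.
  apply: mulr_ge0; first by rewrite invr_ge0 mulr_ge0 ?ltW.
  by rewrite addr_ge0// mulr_ge0 ?sqr_ge0// subr_ge0.
rewrite Rintegral_cst_itv ?(ltW T0)// RintegralD ?RintegralD// ?RintegralZl//;
  try exact: integrable_cst_itv.
rewrite Rintegral_cst_itv ?(ltW T0)//.
have -> : \int[mu]_(t in `[0, T]) drift sigma m b t = 0.
  by case: flow_mb => _ _ _ /(_ _ (ltW T0)); rewrite !mp ?(ltW T0)//; lra.
have : \int[mu]_(t in `[0, T]) mean_gap D m b t <= delta ^+ 2 / 2 * T.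
  rewrite -lee_fin /Rintegral fineK//; exact: integrable_fin_num.
move=> G; rewrite mulr0 add0r => H.
have {}H : s * x * T <= delta * T.
  apply: le_trans H _; apply: (@le_trans _ _
    (delta^-1 * (delta ^+ 2 / 2 * T) + delta * (2^-1 * T))).
    by rewrite lerD2r ler_pM2l ?invr_gt0.
  rewrite le_eqVlt; apply/orP; left; apply/eqP; field; exact: lt0r_neq0.
by rewrite ler_pM2r in H.
Qed.

End constant_flow.

(** Under the constant optimal feedback the forward equation is linear with
    constant coefficients, and [p] is its equilibrium. *)
Lemma balanced_flow_constant (R : realType) (sigma p D : R) (m : R -> R) :
  0 < sigma -> controlled_flow sigma m (fun=> feedback D) -> m 0 = p ->
  balanced sigma p D -> forall t, 0 <= t -> m t = p.
Proof.
move=> sigma0 flow m0 bal t t0.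
pose K := sigma ^+ 2 + feedback D false + (sigma ^+ 2 + feedback D true).
have K0 : 0 < K by rewrite addr_gt0// ltr_pwDl ?feedback_ge0// exprn_gt0.
have driftE s : drift sigma m (fun=> feedback D) s = - K * (m s - p).
  by move: bal; rewrite /drift /balanced /K => bal; lra.
have [mm m01 _ fwd] := flow.
have mw : measurable_fun (`[0, +oo[ : set (measurableTypeR R)) (fun s => `|m s - p|).
  by apply: measurableT_comp => //; exact: measurable_funB.
have wM s : 0 <= s -> 0 <= `|m s - p| <= 1 + `|p|.
  move=> /m01 /andP[s0 s1]; rewrite normr_ge0/= (le_trans (ler_normB _ _))//.
  by rewrite lerD2r ger0_norm.
apply/eqP; rewrite -subr_eq0 -normr_eq0; apply/eqP.
apply: (gronwall_zero K0 mw wM _ t0) => T T0.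
have iD := integrable_drift flow T0.
rewrite (fwd _ T0) m0 addrC addKr EFin_normr_Rintegral//.
rewrite -ge0_integralZl ?lee_fin ?(ltW K0)//; last first.
  apply/measurable_EFinP; apply: (measurable_funS _ _ mw) => //.
  by move=> s /=; rewrite !in_itv /= => /andP[->].
apply: le_trans (le_abse_integral _ _ _) _ => //; first exact: measurable_int iD.
rewrite le_eqVlt; apply/orP; left; apply/eqP; apply: eq_integral => s _.
by rewrite /= driftE normrM normrN (gtr0_norm K0) EFinM.
Qed.

(** * Equilibria of the controlled chain *)

Section limsup_at_infinity.
Context (R : realType) (F : R -> \bar R).

Lemma limf_esup_le_near (x : R) :
  (forall eps, 0 < eps -> \forall T \near +oo, (F T <= (x + eps)%:E)%E) ->
  (limf_esup F +oo%R <= x%:E)%E.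
Proof.
move=> Fx; apply/lee_addgt0Pr => eps eps0; have FV := Fx _ eps0.
apply: (@le_trans _ _ (ereal_sup (F @` [set T | (F T <= (x + eps)%:E)%E]))).
  by apply: ereal_inf_lbound; exists [set T | (F T <= (x + eps)%:E)%E].
by apply: ub_ereal_sup => _ [T FT <-].
Qed.

Lemma near_lt_limf_esup (y : \bar R) : (limf_esup F +oo%R < y)%E ->
  \forall T \near +oo, (F T < y)%E.
Proof.
move=> /ereal_inf_lt[_ [V Voo <-] Vy].
apply: filterS Voo => T VT; apply: le_lt_trans Vy.
by apply: ereal_sup_ubound; exists T.
Qed.

Lemma le_limf_esup_near (x : R) :
  (forall eps, 0 < eps -> \forall T \near +oo, ((x - eps)%:E <= F T)%E) ->
  (x%:E <= limf_esup F +oo%R)%E.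
Proof.
move=> xF; apply/lee_addgt0Pr => eps eps0; rewrite leNgt; apply/negP => lt.
have lt' : (limf_esup F +oo%R < (x - eps)%:E)%E.
  by rewrite EFinB lteBrDr.
have := near_lt_limf_esup lt' => nlt.
have [T [/= FT]] := @filter_ex _ _ _ _ (filterI nlt (xF _ eps0)).
by rewrite leNgt FT.
Qed.

End limsup_at_infinity.

Section chain.
Context (R : realType) (d : measure_display) (Om : measurableType d).
Context (P : probability Om R) (sigma : R).
Context (X : R -> control R -> R -> Om -> bool).
Hypothesis chainX : controlled_chain P sigma X.
Let mu := @lebesgue_measure R.

Lemma chain_controlled_flow (p : R) (b : control R) : 0 <= p <= 1 ->
  admissible b -> controlled_flow sigma (prob1 P (X p b)) b.
Proof.
move=> p01 ab; have cX := chainX p01 ab.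
have [mX [rX _] _ _ _] := cX; have [b0 ib] := ab.
split => //.
- apply: measurable_prob1 => // t /=; rewrite in_itv /= andbT//.
- by move=> t t0; rewrite prob1_ge0 prob1_le1.
- move=> T T0.
  have ir y T' : 0 <= T' -> mu.-integrable `[0, T']
      (EFin \o ((fun t x => sigma ^+ 2 + b t x) ^~ y)).
    move=> T'0.
    exact: (integrableD _ (integrable_cst_itv (sigma ^+ 2) T') (ib y T' T'0)).
  by rewrite (forward_equation cX ir T0) (prob1_start cX).
Qed.

Lemma chain_prob1_start (p : R) (b : control R) : 0 <= p <= 1 ->
  admissible b -> prob1 P (X p b) 0 = p.
Proof. by move=> p01 ab; exact: prob1_start (chainX p01 ab). Qed.

Section costs.
Context (kappa p : R) (b : control R).
Hypothesis kappa_ge0 : 0 <= kappa.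
Hypothesis p01 : 0 <= p <= 1.
Hypothesis ab : admissible b.
Let m := prob1 P (X p b).
Let flow : controlled_flow sigma m b := chain_controlled_flow p01 ab.

Lemma discounted_costE (beta : R) :
  discounted_cost P X kappa beta (fun=> p) b =
  discounted_integral beta (mean_cost kappa p m b).
Proof.
have [mX [rX _] _ _ _] := chainX p01 ab.
rewrite /discounted_cost (integral_along_paths P mX rX
  (f := fun t x => expR (- (beta * t)) * running_cost kappa (fun=> p) b t x))//.
- apply: eq_integral => t _; congr (_%:E).
  by rewrite /mean_cost /state_mean /m; ring.
- by move=> t /=; rewrite in_itv /= andbT.
- move=> y; apply: measurable_funM; first exact: measurable_discount.
  exact: (measurable_running_cost _ _ flow).
- move=> t y; rewrite /= in_itv /= andbT => t0.
  by rewrite mulr_ge0 ?expR_ge0// (running_cost_ge0 b kappa_ge0 p01).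
Qed.

Lemma ergodic_costE :
  ergodic_cost P X kappa (fun=> p) b =
  limf_esup (fun T : R => (T^-1)%:E *
    \int[mu]_(t in `[0%R, T]) (mean_cost kappa p m b t)%:E)%E +oo%R.
Proof.
have [mX [rX _] _ _ _] := chainX p01 ab.
rewrite /ergodic_cost; congr (limf_esup _ _); apply/funext => T; congr (_ * _)%E.
have sub : (`[0, T] : set R) `<=` (`[0, +oo[ : set R).
  by move=> t /=; rewrite !in_itv /= => /andP[->].
rewrite (integral_along_paths P mX rX (f := running_cost kappa (fun=> p) b))//.
- by move=> t /sub /=; rewrite in_itv /= andbT.
- move=> y; apply: (measurable_funS _ sub) => //.
  exact: (measurable_running_cost _ _ flow).
- move=> t y /sub; rewrite /= in_itv /= andbT => t0.
  exact: (running_cost_ge0 b kappa_ge0 p01).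
Qed.

End costs.

Section stationary_nash_iff_balanced.
Context (kappa beta p D : R).
Hypothesis sigma_gt0 : 0 < sigma.
Hypothesis kappa_ge0 : 0 <= kappa.
Hypothesis p01 : 0 <= p <= 1.
Hypothesis hjbD : hjb sigma beta kappa p D.

Let fb : control R := fun=> feedback D.
Let afb : admissible fb. Proof. exact: admissible_feedback. Qed.
Let flow b (ab : admissible b) := chain_controlled_flow p01 ab.

Let optimal (J : control R -> \bar R) (a : control R) :=
  forall b, admissible b -> (J a <= J b)%E.

Let small_gap (a : control R) := forall eps, 0 < eps -> exists2 T, 0 < T &
  (\int[mu]_(t in `[0%R, T]) (mean_gap D (prob1 P (X p a)) a t)%:E
     <= (eps * T)%:E)%E.

(** The part common to both models: if the optimal feedback is optimal and any
    control that costs no more has a small gap, then an equilibrium exists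
    exactly when the optimal feedback preserves [p]. *)
Let equilibrium_iff_balanced (J : control R -> \bar R) :
  optimal J fb ->
  (forall a, admissible a -> (J a <= J fb)%E -> small_gap a) ->
  equilibrium P X J (fun=> p) <-> balanced sigma p D.
Proof.
move=> optfb small; split=> [[_ [a [aa opta law]]]|bal].
  have mp t : 0 <= t -> prob1 P (X p a) t = p.
    by move=> t0; rewrite /prob1 (law t t0).
  apply: (balanced_of_small_gap p01 (flow aa) mp).
  exact/small/opta.
split=> //; exists fb; split=> // t t0.
have [mX _ _ _ _] := chainX p01 afb.
rewrite [LHS](prob1E P mX t0); congr (_%:E).
by apply: balanced_flow_constant bal _ t0 => //; [exact: flow|exact: chain_prob1_start].
Qed.

(** An optimal control has discounted gap zero, hence gap zero on any bounded
    horizon. *)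
Lemma discounted_nash_iff_balanced : 0 < beta ->
  discounted_nash P X kappa beta (fun=> p) <-> balanced sigma p D.
Proof.
move=> beta_gt0; rewrite /discounted_nash.
have JE b : admissible b -> discounted_cost P X kappa beta (fun=> p) b =
    (discounted_integral beta (mean_gap D (prob1 P (X p b)) b) +
     (base_value sigma kappa p D / beta + D * p)%:E)%E.
  move=> ab; rewrite discounted_costE//.
  by rewrite (discounted_mean_cost kappa_ge0 p01 (flow ab) beta_gt0 hjbD)
    (chain_prob1_start p01 ab).
have gap_ge0 b : admissible b ->
    (0 <= discounted_integral beta (mean_gap D (prob1 P (X p b)) b))%E.
  by move=> ab; apply: discounted_integral_ge0 => t; exact: (mean_gap_ge0 D (flow ab)).
have Jfb : discounted_cost P X kappa beta (fun=> p) fb =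
    (base_value sigma kappa p D / beta + D * p)%:E.
  rewrite JE// [X in (X + _)%E](_ : _ = 0%E) ?add0e//.
  by apply: integral0_eq => t _; rewrite mean_gap_feedback mulr0.
apply: equilibrium_iff_balanced.
  by move=> b ab; rewrite Jfb JE// leeDr// gap_ge0.
move=> a aa; rewrite Jfb JE// -leeBrDr// -EFinB subrr => gap_le0 eps eps0; exists 1 => //.
apply: le_trans (integral_le_discounted beta_gt0 ler01
  (measurable_mean_gap D (flow aa)) (mean_gap_ge0 D (flow aa))) _.
have -> : discounted_integral beta (mean_gap D (prob1 P (X p a)) a) = 0%E.
  by apply/eqP; rewrite eq_le gap_le0 gap_ge0.
by rewrite mule0 lee_fin mulr1 ltW.
Qed.

(** The average cost over [0, T] is [base_value] plus the average gap, up to an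
    error of at most [`|D| / T]; so the average gap of an optimal control tends
    to zero. *)
Lemma ergodic_nash_iff_balanced : beta = 0 ->
  ergodic_nash P X kappa (fun=> p) <-> balanced sigma p D.
Proof.
move=> beta0; rewrite /ergodic_nash.
suff -> : equilibrium P X (ergodic_cost P X kappa (fun=> p)) (fun=> p) <->
    balanced sigma p D.
  by split=> [[]//|bal]; split=> //; right.
set lam := base_value sigma kappa p D.
pose G b T := (\int[mu]_(t in `[0%R, T])
  (mean_gap D (prob1 P (X p b)) b t)%:E)%E.
have avgE b T : admissible b -> 0 < T -> exists2 r, `|r| <= `|D| &
    ((T^-1)%:E * \int[mu]_(t in `[0%R, T])
      (mean_cost kappa p (prob1 P (X p b)) b t)%:E =
    (T^-1)%:E * G b T + (lam + r / T)%:E)%E.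
  move=> ab T0; have fl := flow ab; have [_ m01 _ _] := fl.
  have /andP[? ?] := m01 T (ltW T0); have /andP[? ?] := m01 0 (lexx 0).
  exists (- (D * (prob1 P (X p b) T - prob1 P (X p b) 0))).
    by rewrite normrN normrM ler_piMr// ler_norml; lra.
  rewrite (undiscounted_mean_cost kappa_ge0 p01 fl beta0 hjbD (ltW T0)).
  rewrite muleDr//; last exact: fin_num_adde_defl.
  congr (_ + _)%E; rewrite -EFinM; congr (_%:E); rewrite /lam; field.
  exact: lt0r_neq0.
have G0 b T : admissible b -> (0 <= G b T)%E.
  move=> ab; apply: integral_ge0 => t; rewrite /= in_itv /= => /andP[t0 _].
  by rewrite lee_fin (mean_gap_ge0 D (flow ab)).
have near_large eps : 0 < eps -> \forall T \near +oo, 0 < T /\ `|D| / T <= eps.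
  move=> eps0; exists (`|D| / eps); split; first exact: num_real.
  move=> T DT; have T0 : 0 < T by apply: le_lt_trans DT; rewrite divr_ge0// ltW.
  by split => //; rewrite ler_pdivrMr// mulrC -ler_pdivrMr// ltW.
have rT r T eps : `|r| <= `|D| -> 0 < T -> `|D| / T <= eps -> `|r / T| <= eps.
  move=> rD T0; apply: le_trans.
  by rewrite normrM normfV (gtr0_norm T0) ler_pM2r ?invr_gt0.
have Jfb : (ergodic_cost P X kappa (fun=> p) fb <= lam%:E)%E.
  rewrite ergodic_costE//; apply: limf_esup_le_near => eps eps0.
  apply: filterS (near_large _ eps0) => T [T0 DT].
  have [r rD ->] := avgE fb T afb T0.
  have -> : G fb T = 0%E.
    by apply: integral0_eq => t _; rewrite mean_gap_feedback.
  rewrite mule0 add0e lee_fin lerD2l.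
  by have := rT _ _ _ rD T0 DT; rewrite ler_norml => /andP[].
apply: equilibrium_iff_balanced.
  move=> b ab; apply: le_trans Jfb _.
  rewrite ergodic_costE//; apply: le_limf_esup_near => eps eps0.
  apply: filterS (near_large _ eps0) => T [T0 DT].
  have [r rD ->] := avgE b T ab T0.
  apply: (@le_trans _ _ (lam + r / T)%:E); last first.
    by rewrite leeDr// mule_ge0 ?G0// lee_fin invr_ge0 ltW.
  by rewrite lee_fin lerD2l; have := rT _ _ _ rD T0 DT; rewrite ler_norml => /andP[].
move=> a aa /le_trans/(_ Jfb) Ja eps eps0.
have e2 : 0 < eps / 2 by rewrite divr_gt0.
have : (ergodic_cost P X kappa (fun=> p) a < (lam + eps / 2)%:E)%E.
  by apply: le_lt_trans Ja _; rewrite lte_fin ltrDl.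
rewrite ergodic_costE// => /near_lt_limf_esup nlt.
have [T [/= FT [T0 DT]]] := @filter_ex _ _ _ _ (filterI nlt (near_large _ e2)).
exists T => //; have [r rD E] := avgE a T aa T0; move: FT; rewrite E => /ltW FT.
have {}DT := rT _ _ _ rD T0 DT; move: DT; rewrite ler_norml => /andP[DT _].
rewrite -/(G a T).
have : ((T^-1)%:E * G a T <= eps%:E)%E.
  rewrite -leeBrDr// -EFinB in FT; apply: le_trans FT _; rewrite lee_fin; lra.
by rewrite mulrC EFinM -lee_pdivrMl.
Qed.

Lemma nash_iff_balanced : 0 <= beta ->
  nash P X kappa beta (fun=> p) <-> balanced sigma p D.
Proof.
rewrite /nash; case: eqP => [b0 _|/eqP bn0 b0].
  exact: ergodic_nash_iff_balanced.
by apply: discounted_nash_iff_balanced; rewrite lt0r bn0.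
Qed.

End stationary_nash_iff_balanced.
End chain.

(** * Solving for the stationary equilibria *)

Section synchronization_level.
Context (R : realType) (sigma beta : R).
Hypothesis sigma_gt0 : 0 < sigma.
Hypothesis beta_ge0 : 0 <= beta.
Implicit Types kappa D q : R.

Local Notation s2 := (sigma ^+ 2).
Local Notation abar := (abar sigma beta).
Local Notation qbar := (qbar sigma beta).
Local Notation kappa_c := (kappa_c sigma beta).

Let s2_gt0 : 0 < s2. Proof. exact: exprn_gt0. Qed.

Lemma kappa_c_gt0 : 0 < kappa_c.
Proof.
apply: ltr_wpDl; last by rewrite mulr_gt0// exprn_gt0.
by rewrite mulr_ge0 ?(ltW s2_gt0)// mulr_ge0.
Qed.

Lemma abar_root kappa : kappa_c <= kappa ->
  abar kappa ^+ 2 / 2 + (beta + 3 * s2) * abar kappa + kappa_c = kappa.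
Proof.
move=> le; rewrite /Defs.abar; set r := Num.sqrt _.
have : r ^+ 2 = (beta + 3 * s2) ^+ 2 + 2 * (kappa - kappa_c).
  by rewrite sqr_sqrtr// addr_ge0 ?sqr_ge0// mulr_ge0// subr_ge0.
by move=> r2; nra.
Qed.

Lemma abar_unique kappa D : 0 <= D ->
  D ^+ 2 / 2 + (beta + 3 * s2) * D + kappa_c = kappa -> abar kappa = D.
Proof.
move=> D0 <-; rewrite /Defs.abar.
rewrite (_ : _ + _ = (D + (beta + 3 * s2)) ^+ 2); last by field.
rewrite sqrtr_sqr ger0_norm; first by ring.
by rewrite addr_ge0// addr_ge0// mulr_ge0// ltW.
Qed.

Lemma abar_mono kappa1 kappa2 : kappa_c <= kappa1 -> kappa1 < kappa2 ->
  abar kappa1 < abar kappa2.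
Proof.
move=> c1 k12; rewrite /Defs.abar ltrD2l ltr_sqrt.
  by rewrite ltrD2l ltr_pM2l// ltrD2r.
rewrite ltr_wpDl ?sqr_ge0// mulr_gt0// subr_gt0; exact: le_lt_trans k12.
Qed.

Lemma abar_kappa_c : abar kappa_c = 0.
Proof. by apply: abar_unique => //; rewrite expr0n /= mul0r mulr0 !add0r. Qed.

Lemma abar_gt0 kappa : kappa_c < kappa -> 0 < abar kappa.
Proof. by move=> lt; rewrite -abar_kappa_c abar_mono. Qed.

Lemma qbarE kappa : kappa_c < kappa ->
  qbar kappa = 1 - 2 * s2 / (abar kappa + 2 * s2).
Proof.
move=> /abar_gt0 a0; rewrite /Defs.qbar; field.
by rewrite lt0r_neq0// addr_gt0// mulr_gt0.
Qed.

Lemma qbar_gt0 kappa : kappa_c < kappa -> 0 < qbar kappa.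
Proof. by move=> /abar_gt0 a0; rewrite divr_gt0// addr_gt0// mulr_gt0. Qed.

Lemma qbar_lt1 kappa : kappa_c < kappa -> qbar kappa < 1.
Proof.
move=> lt; rewrite qbarE// ltrBlDr ltrDl divr_gt0 ?mulr_gt0// addr_gt0 ?mulr_gt0//.
exact: abar_gt0.
Qed.

Lemma qbar_mono kappa1 kappa2 : kappa_c < kappa1 -> kappa1 < kappa2 ->
  qbar kappa1 < qbar kappa2.
Proof.
move=> c1 k12; have c2 := lt_trans c1 k12; have a12 := abar_mono (ltW c1) k12.
have a1 := abar_gt0 c1; have a2 := abar_gt0 c2.
have s0 : 0 < 2 * s2 by rewrite mulr_gt0.
rewrite !qbarE// ltrD2l ltrN2 ltr_pM2l// ltf_pV2 ?ltrD2r//.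
  by rewrite posrE addr_gt0.
by rewrite posrE addr_gt0.
Qed.

Lemma cvg_qbar : qbar kappa @[kappa --> +oo] --> (1 : R).
Proof.
apply/cvgrPdist_le => eps eps0; have s0 : 0 < 2 * s2 by rewrite mulr_gt0.
pose M := 2 * s2 / eps; have M0 : 0 < M by rewrite divr_gt0.
(* The interaction strength at which abar equals M. *)
pose kappa0 := M ^+ 2 / 2 + (beta + 3 * s2) * M + kappa_c.
have aM : abar kappa0 = M by exact: abar_unique (ltW M0) erefl.
have c0 : kappa_c < kappa0.
  by rewrite ltrDr ltr_pwDl ?divr_gt0 ?exprn_gt0// mulr_ge0 ?(ltW M0)// addr_ge0// mulr_ge0// ltW.
exists kappa0; split; first exact: num_real.
move=> kappa k0; have := abar_mono (ltW c0) k0; rewrite aM => aMk.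
have a0 : 0 < abar kappa + 2 * s2 by rewrite addr_gt0// (lt_trans M0).
rewrite qbarE ?(lt_trans c0)// opprB addrC subrK gtr0_norm ?divr_gt0//.
rewrite ler_pdivrMr// [eps * _]mulrC -ler_pdivrMr// -/M (le_trans (ltW aMk))//.
by rewrite lerDl ltW.
Qed.

Lemma feedbackE D y :
  feedback D y = (`|D| + (if y then D else - D)) / 2.
Proof.
case: y; rewrite /feedback /Num.max; case: ltP => D0.
- by rewrite ltr0_norm//; lra.
- by rewrite ger0_norm//; lra.
- by rewrite gtr0_norm -?oppr_lt0//; lra.
- by rewrite ler0_norm -?oppr_ge0//; lra.
Qed.

(** In the variable [q = 2 p - 1], invariance reads
    [q = - D / (2 sigma ^+ 2 + `|D|)]. *)
Lemma balancedE q D : balanced sigma ((q + 1) / 2) D <->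
  q * (2 * s2 + `|D|) = - D.
Proof. by rewrite /balanced !feedbackE; split=> E; lra. Qed.

Lemma hjbE kappa q D : hjb sigma beta kappa ((q + 1) / 2) D <->
  beta * D = - (kappa * q) - 2 * s2 * D - D * `|D| / 2.
Proof. by rewrite /hjb !feedbackE; split=> E; lra. Qed.

(** For [D] of the sign of [- q] the equation is quadratic in [`|D|], and its
    larger root is nonnegative. *)
Lemma hjb_solution kappa q : 0 <= kappa ->
  exists D, hjb sigma beta kappa ((q + 1) / 2) D.
Proof.
move=> k0; pose g := beta + 2 * s2.
pose s := - g + Num.sqrt (g ^+ 2 + 2 * (kappa * `|q|)).
have g0 : 0 <= g by rewrite addr_ge0// mulr_ge0// ltW.
have kq0 : 0 <= 2 * (kappa * `|q|) by rewrite !mulr_ge0.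
have s0 : 0 <= s.
  rewrite /s addrC subr_ge0 -[leLHS](ger0_norm g0) -sqrtr_sqr ler_wsqrtr//.
  by rewrite lerDl.
have sE : s ^+ 2 / 2 + g * s = kappa * `|q|.
  rewrite /s; set r := Num.sqrt _.
  have : r ^+ 2 = g ^+ 2 + 2 * (kappa * `|q|) by rewrite sqr_sqrtr// addr_ge0 ?sqr_ge0.
  by move=> r2; nra.
case: (leP 0 q) => q0; [exists (- s)|exists s]; apply/hjbE; move: sE.
  by rewrite normrN (ger0_norm q0) (ger0_norm s0) /g; lra.
by rewrite (ltr0_norm q0) (ger0_norm s0) /g; lra.
Qed.

(** Eliminate [q] between the two equations. Either [D = 0], or a factor [D]
    cancels and [`|D|] solves the quadratic equation whose nonnegative root is
    [abar]; this root is positive only above [kappa_c]. The sign of [D] is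
    opposite to that of [q]. *)
Lemma hjb_balanced_iff kappa q : 0 < kappa ->
  (exists2 D, hjb sigma beta kappa ((q + 1) / 2) D &
     balanced sigma ((q + 1) / 2) D) <->
  q = 0 \/ (kappa_c < kappa /\ (q = qbar kappa \/ q = - qbar kappa)).
Proof.
move=> k0; split.
- case=> D /hjbE H /balancedE B; set h := `|D| in H B.
  have h0 : 0 <= h by exact: normr_ge0.
  have p0 : 0 < 2 * s2 + h by rewrite ltr_pwDl// mulr_gt0.
  have [D0|Dn0] := eqVneq D 0.
    left; apply: (mulIf (lt0r_neq0 p0)); rewrite B D0 mul0r oppr0//.
  right; have eK : h ^+ 2 / 2 + (beta + 3 * s2) * h + kappa_c = kappa.
    apply: (mulfI Dn0).
    have E : kappa * (q * (2 * s2 + h)) = kappa * (- D) by rewrite B.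
    have E' : (beta * D) * (2 * s2 + h) =
        (- (kappa * q) - 2 * s2 * D - D * h / 2) * (2 * s2 + h) by rewrite H.
    by rewrite /Defs.kappa_c; lra.
  have hp : 0 < h by rewrite normr_gt0.
  have aD := abar_unique h0 eK.
  have qh : qbar kappa = h / (h + 2 * s2) by rewrite /Defs.qbar aD.
  split.
    by rewrite -eK ltrDr ltr_pwDl ?divr_gt0 ?exprn_gt0// mulr_ge0// addr_ge0// mulr_ge0// ltW.
  have [D0|D0] := leP 0 D; [right|left]; apply: (mulIf (lt0r_neq0 p0));
    rewrite B qh /h ?(ger0_norm D0) ?(ltr0_norm D0); field.
    by rewrite lt0r_neq0// -(ger0_norm D0) -/h addrC.
  by rewrite lt0r_neq0// -(ltr0_norm D0) -/h addrC.
- case=> [->|[lt qE]].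
    by exists 0; [apply/hjbE|apply/balancedE]; rewrite ?normr0; ring.
  have a0 := abar_gt0 lt; have aK := abar_root (ltW lt).
  have an0 : abar kappa + 2 * s2 != 0 by rewrite lt0r_neq0// addr_gt0// mulr_gt0.
  have key : kappa * qbar kappa =
      (beta + 2 * s2 + abar kappa / 2) * abar kappa.
    rewrite /Defs.qbar -[X in X * _]aK /Defs.kappa_c; field; exact: an0.
  have bal : qbar kappa * (2 * s2 + abar kappa) = abar kappa.
    by rewrite /Defs.qbar [2 * s2 + _]addrC divfK.
  case: qE => ->; [exists (- abar kappa)|exists (abar kappa)].
  + by apply/hjbE; rewrite normrN (gtr0_norm a0); lra.
  + by apply/balancedE; rewrite normrN (gtr0_norm a0); lra.
  + by apply/hjbE; rewrite (gtr0_norm a0); lra.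
  + by apply/balancedE; rewrite (gtr0_norm a0); lra.
Qed.

End synchronization_level.

Lemma stationary_nash_iff (R : realType) (d : measure_display)
    (Om : measurableType d) (P : probability Om R) (sigma beta : R)
    (X : R -> control R -> R -> Om -> bool) (kappa q : R) :
  0 < sigma -> 0 <= beta -> controlled_chain P sigma X -> 0 < kappa ->
  stationary_nash P X kappa beta q <->
  q = 0 \/ (kappa_c sigma beta < kappa /\
    (q = qbar sigma beta kappa \/ q = - qbar sigma beta kappa)).
Proof.
move=> sigma0 beta0 chainX kappa0; rewrite -hjb_balanced_iff//; split.
- move=> N; have p01 : 0 <= (q + 1) / 2 <= 1.
    move: N; rewrite /stationary_nash /nash /ergodic_nash /discounted_nash.
    by case: ifP => _ => [[_ []]|[]] /(_ 0 (lexx 0)).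
  have [D H] := hjb_solution sigma0 beta0 q (ltW kappa0); exists D => //.
  exact/(nash_iff_balanced chainX sigma0 (ltW kappa0) p01 H beta0).
- move=> ex; have [D H B] := ex.
  move: ex => /(hjb_balanced_iff sigma0 beta0 _ kappa0) qE.
  have p01 : 0 <= (q + 1) / 2 <= 1.
    case: qE => [->|[lt]]; first by lra.
    have := qbar_gt0 sigma0 beta0 lt; have := qbar_lt1 sigma0 beta0 lt.
    by move=> ? ? [] ->; lra.
  exact/(nash_iff_balanced chainX sigma0 (ltW kappa0) p01 H beta0).
Qed.

Unset Implicit Arguments.

Theorem lemma5p1 (R : realType) (d : measure_display)
    (Om : measurableType d) (P : probability Om R) (sigma beta : R)
    (X : R -> control R -> R -> Om -> bool)
    (sigma_gt0 : 0 < sigma) (beta_ge0 : 0 <= beta)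
    (chainX : controlled_chain P sigma X) :
  [/\ (forall kappa : R, 0 < kappa -> stationary_nash P X kappa beta 0),
      (forall kappa : R, 0 < kappa -> kappa < kappa_c sigma beta ->
         forall q, stationary_nash P X kappa beta q <-> q = 0),
      (forall kappa : R, kappa_c sigma beta < kappa ->
         [/\ 0 < abar sigma beta kappa,
             uniq [:: - qbar sigma beta kappa; 0; qbar sigma beta kappa] &
             forall q, stationary_nash P X kappa beta q <->
               q \in [:: - qbar sigma beta kappa; 0; qbar sigma beta kappa]]) &
      (forall kappa1 kappa2 : R, kappa_c sigma beta < kappa1 -> kappa1 < kappa2 ->
         qbar sigma beta kappa1 < qbar sigma beta kappa2) /\
      qbar sigma beta kappa @[kappa --> +oo] --> (1 : R)].
Proof.
have SNE kappa q (k0 : 0 < kappa) :=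
  stationary_nash_iff q sigma_gt0 beta_ge0 chainX k0.
split.
- by move=> kappa k0; apply/SNE => //; left.
- move=> kappa k0 kc q; split; last by move=> ->; apply/SNE => //; left.
  by move=> /SNE => /(_ k0)[//|[/lt_trans/(_ kc)]]; rewrite ltxx.
- move=> kappa kc; have k0 : 0 < kappa by apply: lt_trans kc; exact: kappa_c_gt0.
  have q0 : 0 < qbar sigma beta kappa by exact: qbar_gt0.
  split; first exact: abar_gt0.
    have qN : - qbar sigma beta kappa < 0 by rewrite oppr_lt0.
    by rewrite /= !inE (lt_eqF qN) (lt_eqF (lt_trans qN q0)) (lt_eqF q0).
  move=> q; rewrite !inE; split.
    by move=> /SNE => /(_ k0)[->|[_ [] ->]]; rewrite eqxx ?orbT.
  by case/or3P => /eqP ->; apply/SNE => //;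
    [right; split => //; right|left|right; split => //; left].
- by split; [exact: qbar_mono|exact: cvg_qbar].
Qed.
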